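(* Let $A$ be a $C^*$-algebra generated by $n$ isometries $S_1,\dots,S_n$ whose dense $*$-subalgebra $\mathcal{A}$ generated by $S_1,\dots,S_n$ admits derivations $\partial_1,\dots,\partial_n$ with $\partial_i(S_j)=\delta_{ij}S_i$ and $\partial_i(S_j^* )=-\delta_{ij}S_j^*$. Let $(\Omega(\mathcal{A}),\wedge,d)$ be the canonical tame differential calculus on $\mathcal{A}$, let $g$ be a strongly $\sigma$-compatible metric on it, let $\nabla_g$ be the associated Levi-Civita connection, and let $(\omega_{ij})$ and $(\Omega_{ij})$ be the matrices of connection one-forms and curvature two-forms of $\nabla_g$. Then for all $i,j=1,\dots,n$, $$d\Omega_{ij}=\sum_{p=1}^n\big(\Omega_{pj}\wedge\omega_{ip}-\omega_{pj}\wedge\Omega_{ip}\big).$$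
   Context: General notions. A differential calculus on a complex algebra $\mathcal{A}$ is a differential graded algebra $(\Omega(\mathcal{A})=\bigoplus_k\Omega^k(\mathcal{A}),\wedge,d)$ with $\Omega^0(\mathcal{A})=\mathcal{A}$, generated as a differential graded algebra in degree zero. It is quasi-tame if (i) $\Omega^1(\mathcal{A})$ is a finitely generated projective right $\mathcal{A}$-module, (ii) $\Omega^1(\mathcal{A})\otimes_{\mathcal{A}}\Omega^1(\mathcal{A})=\mathrm{Ker}(\wedge)\oplus\mathcal{F}$ as right modules with $\mathcal{F}\cong\Omega^2(\mathcal{A})$, (iii) the idempotent $P_{\rm sym}$ with range $\mathrm{Ker}(\wedge)$ and kernel $\mathcal{F}$ is a bimodule map; put $\sigma=2P_{\rm sym}-1$. It is tame if moreover $\mathcal{Z}(\Omega^1(\mathcal{A}))\otimes_{\mathcal{Z}(\mathcal{A})}\mathcal{A}\to\Omega^1(\mathcal{A})$, $\sum e_i\otimes a_i\mapsto\sum e_ia_i$, is a vector space isomorphism ($\mathcal{Z}$ denotes center) and $\sigma(\omega\otimes\eta)=\eta\otimes\omega$ for $\omega,\eta\in\mathcal{Z}(\Omega^1(\mathcal{A}))$. A pseudo-Riemannian metric is a right $\mathcal{A}$-linear $g:\Omega^1(\mathcal{A})\otimes_{\mathcal{A}}\Omega^1(\mathcal{A})\to\mathcal{A}$ with $g\circ\sigma=g$ and with $\omega\mapsto g(\omega\otimes\,\cdot\,)$ an isomorphism of right modules $\Omega^1(\mathcal{A})\to\mathrm{Hom}_{\mathcal{A}}(\Omega^1(\mathcal{A}),\mathcal{A})$;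 it is strongly $\sigma$-compatible if any two elements of $\{g(\omega\otimes\eta):\omega,\eta\in\mathcal{Z}(\Omega^1(\mathcal{A}))\}$ commute. A connection is a $\mathbb{C}$-linear $\nabla:\Omega^1(\mathcal{A})\to\Omega^1(\mathcal{A})\otimes_{\mathcal{A}}\Omega^1(\mathcal{A})$ with $\nabla(ea)=\nabla(e)a+e\otimes da$; it is torsionless if $\wedge\circ\nabla+d=0$. It is compatible with $g$ if $\Pi_g(\nabla)=d\circ g$, where $\Pi_g(\nabla):\Omega^1(\mathcal{A})\otimes_{\mathcal{A}}\Omega^1(\mathcal{A})\to\Omega^1(\mathcal{A})$ is the well-defined map with $\Pi_g(\nabla)(\omega\otimes\eta a)=(g\otimes\mathrm{id})\sigma_{23}(\nabla(\omega)\otimes\eta+\nabla(\eta)\otimes\omega)\,a+g(\omega\otimes\eta)\,da$ for $\omega,\eta\in\mathcal{Z}(\Omega^1(\mathcal{A}))$, $a\in\mathcal{A}$, and $\sigma_{23}=\mathrm{id}\otimes\sigma$. A Levi-Civita connection for $g$ is a torsionless connection compatible with $g$. On a tame calculus admitting a bilinear pseudo-Riemannian metric, each strongly $\sigma$-compatible metric has a unique Levi-Civita connection (known). The canonical calculus. Fix a faithful state $\tau_0$ on $A$, let $\mathcal{H}=L^2(A,\tau_0)\otimes\mathbb{C}^N$ with $N=2^{[n/2]}$, $\pi(a)=a\otimes 1$, and $\mathcal{D}=\sum_i\partial_i\otimes\gamma_i$, where $\gamma_i$ are gamma matrices on $\mathbb{C}^N$: $\gamma_i^2=1$, $\gamma_i\gamma_j=-\gamma_j\gamma_i$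 for $i\ne j$. Let $(\Omega^\bullet_u(\mathcal{A}),\delta)$ be the reduced universal differential graded algebra of $\mathcal{A}$, $\Pi(a_0\delta a_1\cdots\delta a_k)=a_0[\mathcal{D},a_1]\cdots[\mathcal{D},a_k]$, $J_0^k=\{\omega\in\Omega_u^k(\mathcal{A}):\Pi(\omega)=0\}$. The canonical calculus is $\Omega^k(\mathcal{A}):=\Pi(\Omega^k_u(\mathcal{A}))/\Pi(\delta J_0^{k-1})$ with $d\,\overline{\Pi(\omega)}=\overline{\Pi(\delta\omega)}$ and product induced by multiplication of operators. It is a tame calculus in which $\Omega^1(\mathcal{A})$ is a free bimodule with central basis $e_i=1\otimes\gamma_i$, $d(a)=\sum_i e_i\partial_i(a)$ for $a\in\mathcal{A}$, $d(e_i)=0$, $e_i\wedge e_j=-e_j\wedge e_i$, and $\Omega^2(\mathcal{A})$ is free with basis $\{e_i\wedge e_j\}_{i<j}$; it has the bilinear metric $g_0(e_i\otimes e_j)=\delta_{ij}$. Connection and curvature forms. The Christoffel symbols $\Gamma^i_{jk}\in\mathcal{A}$ are defined by $\nabla_g(e_i)=\sum_{j,k}e_j\otimes e_k\Gamma^i_{jk}$. Put $\omega_{ij}=\sum_k e_k\Gamma^i_{jk}$ and $$\Omega_{ij}=\sum_{1\le k<l\le n}e_k\wedge e_l\Big(\sum_{p=1}^n(\Gamma^p_{jk}\Gamma^i_{pl}-\Gamma^p_{jl}\Gamma^i_{pk})-\partial_l(\Gamma^i_{jk})+\partial_k(\Gamma^i_{jl})\Big).$$ *)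

(* Defs.v *)
From HB Require Import structures.
From mathcomp Require Import all_boot all_order all_algebra.
From mathcomp Require Import complex.
From mathcomp Require Import boolp classical_sets functions reals topology normedtype.
Set Implicit Arguments.
Unset Strict Implicit.
Unset Printing Implicit Defensive.
Import Order.TTheory GRing.Theory Num.Theory.
Import numFieldNormedType.Exports.
Local Open Scope ring_scope.
Local Open Scope classical_set_scope.
Local Open Scope quotient_scope.
Local Open Scope complex_scope.

HB.mixin Record isBimodule (A : pzRingType) M of GRing.Zmodule M := {
  lact : A -> M -> M;
  ract : M -> A -> M;
  lactDl : forall a b x, lact (a + b) x = lact a x + lact b x;
  lactDr : forall a x y, lact a (x + y) = lact a x + lact a y;
  ractDl : forall x y a, ract (x + y) a = ract x a + ract y a;
  ractDr : forall x a b, ract x (a + b) = ract x a + ract x b;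
  lact1 : forall x, lact 1 x = x;
  ract1 : forall x, ract x 1 = x;
  lactM : forall a b x, lact (a * b) x = lact a (lact b x);
  ractM : forall x a b, ract x (a * b) = ract (ract x a) b;
  lractA : forall a x b, ract (lact a x) b = lact a (ract x b)
}.
#[short(type="bimodType")]
HB.structure Definition Bimodule (A : pzRingType) :=
  {M of isBimodule A M & GRing.Zmodule M}.

(* The tensor product M (x)_K N, where K acts on M from the right through ra
   and on N from the left through la: finite formal sums of pairs, two of
   which are identified when no K-balanced biadditive map separates them.
   As the tensor product is universal for such maps, this identifies exactly
   the formal sums with the same image in M (x)_K N. *)
Section Tensor.
Variables (K : Type) (M N : zmodType) (ra : M -> K -> M) (la : K -> N -> N).

Definition balanced (V : zmodType) (phi : M -> N -> V) :=
  [/\ forall x x' y, phi (x + x') y = phi x y + phi x' y,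
      forall x y y', phi x (y + y') = phi x y + phi x y' &
      forall x k y, phi (ra x k) y = phi x (la k y)].

Definition tsum (V : zmodType) (phi : M -> N -> V) (s : seq (M * N)) : V :=
  \sum_(p <- s) phi p.1 p.2.

Definition tequiv (s t : seq (M * N)) : bool :=
  `[< forall (V : zmodType) (phi : M -> N -> V),
        balanced phi -> tsum phi s = tsum phi t >].

Lemma tequiv_equiv : equiv_class_of tequiv.
Proof.
split=> [s|s t|t s u].
- exact/asboolP.
- by apply/asboolP/asboolP => h V phi bphi; rewrite h.
- move=> /asboolP h1 /asboolP h2; apply/asboolP => V phi bphi.
  by rewrite h1 // h2.
Qed.

Canonical tequiv_rel := EquivRelPack tequiv_equiv.

Definition tensor := {eq_quot tequiv}.
HB.instance Definition _ := Choice.on tensor.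
HB.instance Definition _ : EqQuotient _ tequiv tensor := EqQuotient.on tensor.

Definition tens (x : M) (y : N) : tensor := \pi_tensor [:: (x, y)].

(* the map induced by phi; only meaningful for balanced phi (tlift_tens) *)
Definition tlift (V : zmodType) (phi : M -> N -> V) (t : tensor) : V :=
  tsum phi (repr t).

Lemma tlift_pi (V : zmodType) (phi : M -> N -> V) s :
  balanced phi -> tlift phi (\pi_tensor s) = tsum phi s.
Proof.
move=> bphi; have /eqP : \pi_tensor (repr (\pi_tensor s)) = \pi_tensor s.
  by rewrite reprK.
by rewrite eqmodE => /asboolP; apply.
Qed.

Lemma tensor_eqP s t : \pi_tensor s = \pi_tensor t <->
  forall (V : zmodType) (phi : M -> N -> V),
    balanced phi -> tsum phi s = tsum phi t.
Proof.
split=> [/eqP|h]; first by rewrite eqmodE => /asboolP.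
by apply/eqP; rewrite eqmodE; apply/asboolP.
Qed.

Lemma tensorW (P : tensor -> Prop) :
  (forall s, P (\pi_tensor s)) -> forall t, P t.
Proof. by move=> h t; rewrite -[t]reprK. Qed.

Definition tneg (s : seq (M * N)) := [seq (- p.1, p.2) | p <- s].

Lemma tsum_cat (V : zmodType) (phi : M -> N -> V) s t :
  tsum phi (s ++ t) = tsum phi s + tsum phi t.
Proof. by rewrite /tsum big_cat. Qed.

Lemma balanced0l (V : zmodType) (phi : M -> N -> V) y :
  balanced phi -> phi 0 y = 0.
Proof. by case=> h _ _; apply: (@addrI _ (phi 0 y)); rewrite -h !addr0. Qed.

Lemma tsum_neg (V : zmodType) (phi : M -> N -> V) s :
  balanced phi -> tsum phi (tneg s) = - tsum phi s.
Proof.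
move=> bphi; rewrite /tsum big_map -sumrN; apply: eq_bigr => p _ /=.
apply/eqP; rewrite -addr_eq0; case: (bphi) => <- _ _.
by rewrite addNr balanced0l.
Qed.

Definition tadd (s t : tensor) : tensor := \pi_tensor (repr s ++ repr t).
Definition topp (s : tensor) : tensor := \pi_tensor (tneg (repr s)).
Definition tzero : tensor := \pi_tensor [::].

Fact tadd_pi s t : tadd (\pi_tensor s) (\pi_tensor t) = \pi_tensor (s ++ t).
Proof.
apply/tensor_eqP => V phi bphi; rewrite !tsum_cat.
by rewrite -/(tlift phi _) -/(tlift phi (\pi_tensor t)) !tlift_pi.
Qed.
Fact topp_pi s : topp (\pi_tensor s) = \pi_tensor (tneg s).
Proof.
apply/tensor_eqP => V phi bphi; rewrite !tsum_neg //.
by rewrite -/(tlift phi _) !tlift_pi.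
Qed.

Fact taddA : associative tadd.
Proof.
move=> x y z; elim/tensorW: x => s; elim/tensorW: y => t; elim/tensorW: z => u.
by rewrite !tadd_pi catA.
Qed.
Fact taddC : commutative tadd.
Proof.
move=> x y; elim/tensorW: x => s; elim/tensorW: y => t; rewrite !tadd_pi.
by apply/tensor_eqP => V phi _; rewrite !tsum_cat addrC.
Qed.
Fact tadd0 : left_id tzero tadd.
Proof. by move=> x; elim/tensorW: x => s; rewrite tadd_pi. Qed.
Fact taddN : left_inverse tzero topp tadd.
Proof.
move=> x; elim/tensorW: x => s; rewrite topp_pi tadd_pi; apply/tensor_eqP => V phi b.
by rewrite tsum_cat tsum_neg // addNr /tsum big_nil.
Qed.
HB.instance Definition _ := GRing.isZmodule.Build tensor taddA taddC tadd0 taddN.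

Lemma tens_balanced : balanced tens.
Proof.
split=> *.
- rewrite [RHS]tadd_pi; apply/tensor_eqP => V phi [h1 h2 h3].
  by rewrite /tsum !(big_cons, big_nil) /= !addr0 h1.
- rewrite [RHS]tadd_pi; apply/tensor_eqP => V phi [h1 h2 h3].
  by rewrite /tsum !(big_cons, big_nil) /= !addr0 h2.
- apply/tensor_eqP => V phi [h1 h2 h3].
  by rewrite /tsum !(big_cons, big_nil) /= !addr0 h3.
Qed.

Lemma tliftD (V : zmodType) (phi : M -> N -> V) s t :
  balanced phi -> tlift phi (s + t) = tlift phi s + tlift phi t.
Proof.
move=> b; elim/tensorW: s => s; elim/tensorW: t => t.
by rewrite [X in tlift _ X]tadd_pi !tlift_pi // tsum_cat.
Qed.

Lemma tlift_tens (V : zmodType) (phi : M -> N -> V) x y :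
  balanced phi -> tlift phi (tens x y) = phi x y.
Proof. by move=> b; rewrite tlift_pi // /tsum big_cons big_nil addr0. Qed.

Lemma tensor_ind (P : tensor -> Prop) :
  P 0 -> (forall x y t, P t -> P (tens x y + t)) -> forall t, P t.
Proof.
move=> P0 PD t; elim/tensorW: t; elim=> [|[x y] s IH]; first exact: P0.
by have := PD x y _ IH; rewrite [tens x y + _]tadd_pi.
Qed.

Lemma tlift0 (V : zmodType) (phi : M -> N -> V) :
  balanced phi -> tlift phi 0 = 0.
Proof. by move=> b; rewrite tlift_pi // /tsum big_nil. Qed.

End Tensor.

Section BimodTensor.
Variables (A : pzRingType) (M N : bimodType A).

Definition btensor := tensor (@ract A M) (@lact A N).
HB.instance Definition _ := GRing.Zmodule.on btensor.

Definition btens (x : M) (y : N) : btensor := tens _ _ x y.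

Definition bt_la (a : A) : btensor -> btensor := tlift (fun x y => btens (lact a x) y).
Definition bt_ra (t : btensor) (a : A) : btensor := tlift (fun x y => btens x (ract y a)) t.

Fact bt_bla a : balanced (@ract A M) (@lact A N) (fun x y => btens (lact a x) y).
Proof.
have [h1 h2 h3] := tens_balanced (@ract A M) (@lact A N).
by split=> *; rewrite ?lactDr ?h1 ?h2 -?lractA ?h3.
Qed.
Fact bt_bra a : balanced (@ract A M) (@lact A N) (fun x y => btens x (ract y a)).
Proof.
have [h1 h2 h3] := tens_balanced (@ract A M) (@lact A N).
by split=> *; rewrite ?ractDl ?h1 ?h2 ?lractA ?h3.
Qed.
Fact bt_la_tens a x y t : bt_la a (btens x y + t) = btens (lact a x) y + bt_la a t.
Proof.
have b := bt_bla a; rewrite /bt_la tliftD //; congr (_ + _).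
exact: (tlift_tens x y b).
Qed.
Fact bt_ra_tens a x y t : bt_ra (btens x y + t) a = btens x (ract y a) + bt_ra t a.
Proof.
have b := bt_bra a; rewrite /bt_ra tliftD //; congr (_ + _).
exact: (tlift_tens x y b).
Qed.
Fact bt_la0 a : bt_la a 0 = 0. Proof. exact/tlift0/bt_bla. Qed.
Fact bt_ra0 a : bt_ra 0 a = 0. Proof. exact/tlift0/bt_bra. Qed.
Fact btensDl x x' y : btens (x + x') y = btens x y + btens x' y.
Proof. by have [h1 _ _] := tens_balanced (@ract A M) (@lact A N); apply: h1. Qed.
Fact btensDr x y y' : btens x (y + y') = btens x y + btens x y'.
Proof. by have [_ h1 _] := tens_balanced (@ract A M) (@lact A N); apply: h1. Qed.

Fact bt_laDl a b x : bt_la (a + b) x = bt_la a x + bt_la b x.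
Proof.
elim/tensor_ind: x => [|x y t IH]; first by rewrite !bt_la0 addr0.
by rewrite !bt_la_tens IH lactDl btensDl addrACA.
Qed.
Fact bt_laDr a x y : bt_la a (x + y) = bt_la a x + bt_la a y.
Proof. exact/tliftD/bt_bla. Qed.
Fact bt_raDl x y a : bt_ra (x + y) a = bt_ra x a + bt_ra y a.
Proof. exact/tliftD/bt_bra. Qed.
Fact bt_raDr x a b : bt_ra x (a + b) = bt_ra x a + bt_ra x b.
Proof.
elim/tensor_ind: x => [|x y t IH]; first by rewrite !bt_ra0 addr0.
by rewrite !bt_ra_tens IH ractDr btensDr addrACA.
Qed.
Fact bt_la1 x : bt_la 1 x = x.
Proof.
by elim/tensor_ind: x => [|x y t IH]; rewrite ?bt_la0 // bt_la_tens lact1 IH.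
Qed.
Fact bt_ra1 x : bt_ra x 1 = x.
Proof.
by elim/tensor_ind: x => [|x y t IH]; rewrite ?bt_ra0 // bt_ra_tens ract1 IH.
Qed.
Fact bt_laM a b x : bt_la (a * b) x = bt_la a (bt_la b x).
Proof.
by elim/tensor_ind: x => [|x y t IH]; rewrite ?bt_la0 // !bt_la_tens lactM IH.
Qed.
Fact bt_raM x a b : bt_ra x (a * b) = bt_ra (bt_ra x a) b.
Proof.
by elim/tensor_ind: x => [|x y t IH]; rewrite ?bt_ra0 // !bt_ra_tens ractM IH.
Qed.
Fact bt_lraA a x b : bt_ra (bt_la a x) b = bt_la a (bt_ra x b).
Proof.
elim/tensor_ind: x => [|x y t IH]; first by rewrite !(bt_la0, bt_ra0).
by rewrite !(bt_la_tens, bt_ra_tens) IH.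
Qed.
HB.instance Definition _ := isBimodule.Build A btensor
  bt_laDl bt_laDr bt_raDl bt_raDr bt_la1 bt_ra1 bt_laM bt_raM bt_lraA.

End BimodTensor.

Section Center.
Variables (A : pzRingType) (M : bimodType A).

Definition central : {pred M} := fun x => `[< forall a, lact a x = ract x a >].

Lemma central_closed : zmod_closed central.
Proof.
have l0 a : lact a (0 : M) = 0.
  by apply: (@addrI _ (lact a 0)); rewrite -lactDr !addr0.
have r0 a : ract (0 : M) a = 0.
  by apply: (@addrI _ (ract 0 a)); rewrite -ractDl !addr0.
split=> [|x y /asboolP hx /asboolP hy]; apply/asboolP => a; first by rewrite l0 r0.
apply: (@addIr _ (lact a y)); rewrite -lactDr subrK hy -ractDl subrK.
exact: hx.
Qed.
HB.instance Definition _ := GRing.isZmodClosed.Build M central central_closed.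

Record center := Center { center_val :> M; center_valP : center_val \in central }.
HB.instance Definition _ := [isSub for center_val].
HB.instance Definition _ := [Choice of center by <:].
HB.instance Definition _ := [SubChoice_isSubZmodule of center by <:].

Definition ring_center := {z : A | forall a, a * z = z * a}.

Lemma central_ract (x : center) (z : ring_center) :
  ract (x : M) (sval z) \in central.
Proof.
apply/asboolP => a; case: x => x /= /asboolP hx.
by rewrite -lractA hx -!ractM (svalP z).
Qed.

Definition center_ract (x : center) (z : ring_center) : center :=
  Center (central_ract x z).

Definition ring_center_lmul (z : ring_center) (a : A) : A := sval z * a.

End Center.

(* A graded family of A-bimodules with a product and a differential; deg0
   identifies A with the forms of degree 0. *)
Record preCalculus (A : pzRingType) := PreCalculus {
  forms : nat -> bimodType A;
  fwedge : forall k l, forms k -> forms l -> forms (k + l)%N;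
  fdiff : forall k, forms k -> forms k.+1;
  deg0 : A -> forms 0
}.
Arguments forms {A} _ _.
Arguments fwedge {A} _ {k l} _ _.
Arguments fdiff {A} _ {k} _.
Arguments deg0 {A} _ _.

(* transport of forms along an equality of degrees *)
Definition cast_deg (A : pzRingType) (W : preCalculus A) k l (e : k = l)
    (x : forms W k) : forms W l :=
  ecast i (forms W i) e x.

(* da_0 ^ da_1 ^ ... ^ da_(k-1) *)
Fixpoint exact_monomial (A : pzRingType) (W : preCalculus A) (k : nat) :
    (nat -> A) -> forms W k :=
  match k with
  | 0 => fun _ => deg0 W 1
  | k'.+1 => fun a =>
      fwedge W (fdiff W (deg0 W (a 0%N))) (exact_monomial W k' (fun i => a i.+1))
  end.

Record isDiffCalculus (C : fieldType) (A : algType C) (W : preCalculus A) :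
    Prop := IsDiffCalculus {
  wedgeDl : forall k l (x x' : forms W k) (y : forms W l),
    fwedge W (x + x') y = fwedge W x y + fwedge W x' y;
  wedgeDr : forall k l (x : forms W k) (y y' : forms W l),
    fwedge W x (y + y') = fwedge W x y + fwedge W x y';
  wedgeA : forall k l m (x : forms W k) (y : forms W l) (z : forms W m),
    cast_deg (esym (addnA k l m)) (fwedge W (fwedge W x y) z) =
    fwedge W x (fwedge W y z);
  deg0_bij : bijective (deg0 W);
  deg0D : {morph deg0 W : a b / a + b};
  deg0M : forall a b : A, fwedge W (deg0 W a) (deg0 W b) = deg0 W (a * b);
  wedge0l : forall k (a : A) (x : forms W k),
    fwedge W (deg0 W a) x = lact a x;
  wedge0r : forall k (x : forms W k) (a : A),
    cast_deg (addn0 k) (fwedge W x (deg0 W a)) = ract x a;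
  (* the two actions of the scalars agree: the product is C-bilinear *)
  scalar_central : forall k (c : C) (x : forms W k),
    lact c%:A x = ract x c%:A;
  diffD : forall k, {morph @fdiff _ W k : x y / x + y};
  diffZ : forall k (c : C) (x : forms W k),
    fdiff W (lact c%:A x) = lact c%:A (fdiff W x);
  diffK : forall k (x : forms W k), fdiff W (fdiff W x) = 0;
  diffM : forall k l (x : forms W k) (y : forms W l),
    fdiff W (fwedge W x y) =
    fwedge W (fdiff W x) y +
    cast_deg (addnS k l) (lact ((-1) ^+ k) (fwedge W x (fdiff W y)));
  (* generation in degree zero: by diffM, the differential graded subalgebra
     generated by A is spanned by the a0 da1 ... dak *)
  form_gen : forall k (x : forms W k), exists s : seq (A * (nat -> A)),
    x = \sum_(p <- s) lact p.1 (exact_monomial W k p.2)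
}.

Record diffCalculus (C : fieldType) (A : algType C) := DiffCalculus {
  precalc :> preCalculus A;
  precalcP : isDiffCalculus precalc
}.

Section RightModules.
Variables (A : pzRingType).

Definition right_linear (M N : bimodType A) (f : M -> N) :=
  {morph f : x y / x + y} /\ forall x a, f (ract x a) = ract (f x) a.

Definition right_form (M : bimodType A) (f : M -> A) :=
  {morph f : x y / x + y} /\ forall x a, f (ract x a) = f x * a.

Definition right_fin_generated (M : bimodType A) :=
  exists s : seq M, forall x, exists a : 'I_(size s) -> A,
    x = \sum_(i < size s) ract (tnth (in_tuple s) i) (a i).

(* Right A-modules are left modules over the converse ring. *)
Definition right_projective (M : bimodType A) :=
  forall (X Y : lmodType A^c) (p : {linear X -> Y}) (f : M -> Y),
    (forall y, exists x, p x = y) ->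
    {morph f : u v / u + v} ->
    (forall u (a : A), f (ract u a) = (a : A^c) *: f u) ->
    exists h : M -> X,
      [/\ {morph h : u v / u + v},
          forall u (a : A), h (ract u a) = (a : A^c) *: h u &
          forall u, p (h u) = f u].

End RightModules.

Section Tame.
Variables (C : fieldType) (A : algType C) (W : diffCalculus A).

Local Notation Om1 := (forms W 1).
Local Notation Om2 := (forms W 2).
Local Notation T2 := (btensor Om1 Om1).

Definition dalg (a : A) : Om1 := fdiff W (deg0 W a).

Definition wedgeT : T2 -> Om2 := tlift (fun x y : Om1 => fwedge W x y : Om2).

Record quasiTame := QuasiTame {
  qt_fingen : right_fin_generated Om1;
  qt_proj : right_projective Om1;
  qt_F : set T2;
  qt_F0 : qt_F 0;
  qt_FD : forall s t, qt_F s -> qt_F t -> qt_F (s + t);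
  qt_FZ : forall t a, qt_F t -> qt_F (ract t a);
  qt_sum : forall t, exists u v, [/\ wedgeT u = 0, qt_F v & t = u + v];
  qt_direct : forall t, wedgeT t = 0 -> qt_F t -> t = 0;
  qt_F_iso : exists f : T2 -> Om2,
    [/\ forall s t, qt_F s -> qt_F t -> f (s + t) = f s + f t,
        forall t a, qt_F t -> f (ract t a) = ract (f t) a &
        set_bij qt_F setT f];
  Psym : T2 -> T2;
  PsymD : {morph Psym : s t / s + t};
  Psym_idem : forall t, Psym (Psym t) = Psym t;
  Psym_range : range Psym = [set t | wedgeT t = 0];
  Psym_ker : [set t | Psym t = 0] = qt_F;
  Psym_ract : forall t a, Psym (ract t a) = ract (Psym t) a;
  Psym_lact : forall a t, Psym (lact a t) = lact a (Psym t)
}.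

Definition sigma (Q : quasiTame) (t : T2) : T2 := Psym Q t *+ 2 - t.

(* Z(Omega^1) (x)_{Z(A)} A --> Omega^1; additive and right A-linear, hence
   C-linear, by construction *)
Definition center_mult :
    tensor (@center_ract A Om1) (@ring_center_lmul A) -> Om1 :=
  tlift (fun (e : center Om1) (a : A) => ract (e : Om1) a).

Record tame := Tame {
  tame_quasi :> quasiTame;
  tame_center : bijective center_mult;
  tame_flip : forall w h : Om1, w \in @central A Om1 -> h \in @central A Om1 ->
    sigma tame_quasi (btens w h) = btens h w
}.

Record metric (Q : quasiTame) := Metric {
  metric_fun :> T2 -> A;
  metric_right : right_form metric_fun;
  metric_sym : forall t, metric_fun (sigma Q t) = metric_fun t;
  (* w |-> g(w (x) . ) is automatically right linear; it is bijective onto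
     the right A-linear maps Omega^1 -> A *)
  metric_nondeg : forall f : Om1 -> A, right_form f ->
    exists! w : Om1, forall h, metric_fun (btens w h) = f h
}.

Definition strongly_compatible (Q : quasiTame) (g : metric Q) :=
  forall w h w' h' : Om1,
    w \in @central A Om1 -> h \in @central A Om1 ->
    w' \in @central A Om1 -> h' \in @central A Om1 ->
    g (btens w h) * g (btens w' h') = g (btens w' h') * g (btens w h).

Record connection := Connection {
  conn_fun :> Om1 -> T2;
  connD : {morph conn_fun : x y / x + y};
  connZ : forall (c : C) x, conn_fun (lact c%:A x) = lact c%:A (conn_fun x);
  connM : forall e a,
    conn_fun (ract e a) = ract (conn_fun e) a + btens e (dalg a)
}.

Definition torsionless (nabla : connection) :=
  forall w, wedgeT (nabla w) + fdiff W w = 0.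

Section TripleTensor.
Local Notation T3l := (btensor T2 Om1).
Local Notation T3r := (btensor Om1 T2).

Definition tassoc : T3l -> T3r :=
  tlift (fun (t : T2) z => tlift (fun x y => btens x (btens y z) : T3r) t).
Definition tassocV : T3r -> T3l :=
  tlift (fun x (t : T2) => tlift (fun y z => btens (btens x y : T2) z : T3l) t).

Definition sigma23 (Q : quasiTame) (t : T3l) : T3l :=
  tassocV (tlift (fun x (s : T2) => btens x (sigma Q s) : T3r) (tassoc t)).

(* g (x) id, followed by A (x)_A Omega^1 = Omega^1 *)
Definition metric_id (Q : quasiTame) (g : metric Q) : T3l -> Om1 :=
  tlift (fun (t : T2) z => lact (g t) z).
End TripleTensor.

(* P is the map Pi_g(nabla); tame calculi have exactly one such P. *)
Definition is_Pi (Q : quasiTame) (g : metric Q) (nabla : connection)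
    (P : T2 -> Om1) :=
  {morph P : s t / s + t} /\
  forall (w h : Om1) (a : A),
    w \in @central A Om1 -> h \in @central A Om1 ->
    P (btens w (ract h a)) =
      ract (metric_id g (sigma23 Q
              (btens (nabla w) h + btens (nabla h) w : btensor T2 Om1))) a
      + lact (g (btens w h)) (dalg a).

Definition metric_compatible (Q : quasiTame) (g : metric Q)
    (nabla : connection) :=
  exists2 P, is_Pi g nabla P & forall t, P t = dalg (g t).

Definition levi_civita (Q : quasiTame) (g : metric Q) (nabla : connection) :=
  torsionless nabla /\ metric_compatible g nabla.

End Tame.

(* The reduced universal differential graded algebra of A: the algebra
   generated by symbols a and da for a in A, subject to a |-> a being a unital
   algebra morphism and a |-> da a C-linear derivation (so d1 = 0).  Its
   homogeneous elements of degree k are the sums of a0 da1 ... dak. *)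
Inductive uterm (A : Type) :=
| UIn of A | UDel of A | UAdd of uterm A & uterm A | UMul of uterm A & uterm A.

Section Universal.
Variables (C : fieldType) (A : algType C).
Local Notation term := (uterm A).

Local Notation "x :+ y" := (UAdd x y) (at level 50, left associativity).
Local Notation "x :** y" := (UMul x y) (at level 40, left associativity).

Inductive ueq : term -> term -> Prop :=
| ueq_refl x : ueq x x
| ueq_sym x y : ueq x y -> ueq y x
| ueq_trans x y z : ueq x y -> ueq y z -> ueq x z
| ueq_add x x' y y' : ueq x x' -> ueq y y' -> ueq (x :+ y) (x' :+ y')
| ueq_mul x x' y y' : ueq x x' -> ueq y y' -> ueq (x :** y) (x' :** y')
| ueq_addA x y z : ueq (x :+ (y :+ z)) (x :+ y :+ z)
| ueq_addC x y : ueq (x :+ y) (y :+ x)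
| ueq_add0 x : ueq (UIn 0 :+ x) x
| ueq_addN x : ueq (UIn (-1) :** x :+ x) (UIn 0)
| ueq_mulA x y z : ueq (x :** (y :** z)) (x :** y :** z)
| ueq_mul1l x : ueq (UIn 1 :** x) x
| ueq_mul1r x : ueq (x :** UIn 1) x
| ueq_mulDl x y z : ueq ((x :+ y) :** z) (x :** z :+ y :** z)
| ueq_mulDr x y z : ueq (x :** (y :+ z)) (x :** y :+ x :** z)
| ueq_inD a b : ueq (UIn (a + b)) (UIn a :+ UIn b)
| ueq_inM a b : ueq (UIn (a * b)) (UIn a :** UIn b)
| ueq_delD a b : ueq (UDel (a + b)) (UDel a :+ UDel b)
| ueq_delZ (c : C) a : ueq (UDel (c *: a)) (UIn c%:A :** UDel a)
| ueq_delM a b : ueq (UDel (a * b)) (UDel a :** UIn b :+ UIn a :** UDel b).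

HB.instance Definition _ := gen_eqMixin term.
HB.instance Definition _ := gen_choiceMixin term.

Definition ueqb (x y : term) : bool := `[< ueq x y >].

Lemma ueqb_equiv : equiv_class_of ueqb.
Proof.
split=> [x|x y|y x z]; first exact/asboolP/ueq_refl.
- by apply/asboolP/asboolP; apply: ueq_sym.
- by move=> /asboolP h1 /asboolP h2; apply/asboolP; apply: ueq_trans h1 h2.
Qed.

Canonical ueqb_rel := EquivRelPack ueqb_equiv.

Definition univ := {eq_quot ueqb}.
HB.instance Definition _ := Choice.on univ.
HB.instance Definition _ : EqQuotient _ ueqb univ := EqQuotient.on univ.

Definition ucl (t : term) : univ := \pi_univ t.

Lemma ucl_eq s t : ueq s t -> ucl s = ucl t.
Proof. by move=> h; apply/eqP; rewrite eqmodE; apply/asboolP. Qed.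

Lemma ucl_eqP s t : ucl s = ucl t -> ueq s t.
Proof. by move=> /eqP; rewrite eqmodE => /asboolP. Qed.

Lemma univW (P : univ -> Prop) : (forall t, P (ucl t)) -> forall x, P x.
Proof. by move=> h x; rewrite -[x]reprK. Qed.

Definition uadd (x y : univ) := ucl (repr x :+ repr y).
Definition umul (x y : univ) := ucl (repr x :** repr y).
Definition uopp (x : univ) := ucl (UIn (-1) :** repr x).

Lemma repr_ucl t : ueq (repr (ucl t)) t.
Proof. by apply: ucl_eqP; rewrite /ucl reprK. Qed.

Lemma uadd_cl s t : uadd (ucl s) (ucl t) = ucl (s :+ t).
Proof. by apply/ucl_eq/ueq_add; apply: repr_ucl. Qed.
Lemma umul_cl s t : umul (ucl s) (ucl t) = ucl (s :** t).
Proof. by apply/ucl_eq/ueq_mul; apply: repr_ucl. Qed.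
Lemma uopp_cl s : uopp (ucl s) = ucl (UIn (-1) :** s).
Proof. by apply/ucl_eq/ueq_mul; [apply: ueq_refl | apply: repr_ucl]. Qed.

Fact uaddA : associative uadd.
Proof.
move=> x y z; elim/univW: x => x; elim/univW: y => y; elim/univW: z => z.
by rewrite !uadd_cl; apply/ucl_eq/ueq_addA.
Qed.
Fact uaddC : commutative uadd.
Proof.
move=> x y; elim/univW: x => x; elim/univW: y => y.
by rewrite !uadd_cl; apply/ucl_eq/ueq_addC.
Qed.
Fact uadd0 : left_id (ucl (UIn 0)) uadd.
Proof.
by move=> x; elim/univW: x => x; rewrite !uadd_cl; apply/ucl_eq/ueq_add0.
Qed.
Fact uaddN : left_inverse (ucl (UIn 0)) uopp uadd.
Proof.
move=> x; elim/univW: x => x; rewrite uopp_cl uadd_cl.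
exact/ucl_eq/ueq_addN.
Qed.
HB.instance Definition _ := GRing.isZmodule.Build univ uaddA uaddC uadd0 uaddN.

Fact umulA : associative umul.
Proof.
move=> x y z; elim/univW: x => x; elim/univW: y => y; elim/univW: z => z.
by rewrite !umul_cl; apply/ucl_eq/ueq_mulA.
Qed.
Fact umul1l : left_id (ucl (UIn 1)) umul.
Proof.
by move=> x; elim/univW: x => x; rewrite !umul_cl; apply/ucl_eq/ueq_mul1l.
Qed.
Fact umul1r : right_id (ucl (UIn 1)) umul.
Proof.
by move=> x; elim/univW: x => x; rewrite !umul_cl; apply/ucl_eq/ueq_mul1r.
Qed.
Fact umulDl : left_distributive umul +%R.
Proof.
move=> x y z; elim/univW: x => x; elim/univW: y => y; elim/univW: z => z.
by rewrite /GRing.add /= !(umul_cl, uadd_cl); apply/ucl_eq/ueq_mulDl.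
Qed.
Fact umulDr : right_distributive umul +%R.
Proof.
move=> x y z; elim/univW: x => x; elim/univW: y => y; elim/univW: z => z.
by rewrite /GRing.add /= !(umul_cl, uadd_cl); apply/ucl_eq/ueq_mulDr.
Qed.
HB.instance Definition _ := GRing.Zmodule_isPzRing.Build univ
  umulA umul1l umul1r umulDl umulDr.

Definition uin (a : A) : univ := ucl (UIn a).
Definition ud (a : A) : univ := ucl (UDel a).

Lemma uclD s t : ucl (s :+ t) = ucl s + ucl t.
Proof. by rewrite [RHS]uadd_cl. Qed.
Lemma uclM s t : ucl (s :** t) = ucl s * ucl t.
Proof. by rewrite [RHS]umul_cl. Qed.

Lemma uinD a b : uin (a + b) = uin a + uin b.
Proof. by rewrite -uclD; apply/ucl_eq/ueq_inD. Qed.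
Lemma uinM a b : uin (a * b) = uin a * uin b.
Proof. by rewrite -uclM; apply/ucl_eq/ueq_inM. Qed.
Lemma uin1 : uin 1 = 1. Proof. by []. Qed.
Lemma uin0 : uin 0 = 0. Proof. by []. Qed.
Lemma uinN a : uin (- a) = - uin a.
Proof. by apply/eqP; rewrite -addr_eq0 -uinD addNr. Qed.
Lemma udD a b : ud (a + b) = ud a + ud b.
Proof. by rewrite -uclD; apply/ucl_eq/ueq_delD. Qed.
Lemma udZ c a : ud (c *: a) = uin c%:A * ud a.
Proof. by rewrite -uclM; apply/ucl_eq/ueq_delZ. Qed.
Lemma udM a b : ud (a * b) = ud a * uin b + uin a * ud b.
Proof. by rewrite -!uclM -uclD; apply/ucl_eq/ueq_delM. Qed.
Lemma ud1 : ud 1 = 0.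
Proof.
apply: (@addrI _ (ud 1)); rewrite addr0 -[X in _ = ud X]mulr1 udM uin1.
by rewrite mulr1 mul1r.
Qed.
Lemma ud_scal c : ud c%:A = 0.
Proof. by rewrite udZ ud1 mulr0. Qed.

(* parity automorphism: multiplication by (-1)^k in degree k *)
Fixpoint teps (t : term) : univ :=
  match t with
  | UIn a => uin a
  | UDel a => - ud a
  | UAdd x y => teps x + teps y
  | UMul x y => teps x * teps y
  end.

Fixpoint tdelta (t : term) : univ :=
  match t with
  | UIn a => ud a
  | UDel a => 0
  | UAdd x y => tdelta x + tdelta y
  | UMul x y => tdelta x * ucl y + teps x * tdelta y
  end.

Lemma ueq_lift s t : ueq s t -> teps s = teps t /\ tdelta s = tdelta t.
Proof.
move=> h.
suff: [/\ teps s = teps t, tdelta s = tdelta t & ucl s = ucl t] by case.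
elim: h => //=.
- by move=> x y _ [-> -> ->].
- by move=> x y z _ [-> -> ->] _ [-> -> ->].
- by move=> x x' y y' _ [h1 h2 h3] _ [h4 h5 h6]; rewrite !uclD h1 h2 h3 h4 h5 h6.
- move=> x x' y y' _ [h1 h2 h3] _ [h4 h5 h6].
  by rewrite !uclM h1 h2 h3 h4 h5 h6.
- by move=> x y z; rewrite !uclD !addrA.
- by move=> x y; split; rewrite ?uclD addrC.
- move=> x; rewrite uclD -/(uin 0) uin0 !add0r -[in ud 0](scale0r (1 : A)).
  by rewrite ud_scal add0r.
- move=> x; rewrite uclD uclM -/(uin _) -/(uin 0) uinN uin1 uin0.
  have -> : ud (-1) = 0 by rewrite -scaleN1r ud_scal.
  have -> : ud 0 = 0 by rewrite -[in ud 0](scale0r (1 : A)) ud_scal.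
  by rewrite !mulNr !mul1r mul0r add0r !addNr.
- move=> x y z; rewrite !uclM !mulrA !mulrDl !mulrDr !mulrA.
  by rewrite addrA.
- by move=> x; rewrite uclM -/(uin 1) uin1 ud1 mul0r !mul1r add0r.
- by move=> x; rewrite uclM -/(uin 1) uin1 ud1 mulr0 !mulr1 addr0.
- move=> x y z; rewrite !(uclM, uclD) !mulrDl; split=> //.
  by rewrite addrACA.
- move=> x y z; rewrite !(uclM, uclD) !mulrDr; split=> //.
  by rewrite addrACA.
- by move=> a b; rewrite uclD -!/(uin _) uinD udD.
- by move=> a b; rewrite uclM -!/(uin _) uinM udM.
- by move=> a b; rewrite uclD -!/(ud _) udD opprD addr0.
- move=> c a; rewrite uclM -!/(ud _) -/(uin _) udZ ud_scal mul0r mulr0 addr0.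
  by rewrite mulrN.
- move=> a b; rewrite uclD !uclM -!/(ud _) -!/(uin _) udM opprD mulNr mulrN.
  by rewrite mul0r mulr0 add0r addr0 mulNr addNr.
Qed.

Definition ueps (x : univ) : univ := teps (repr x).
Definition udelta (x : univ) : univ := tdelta (repr x).

Lemma ueps_cl t : ueps (ucl t) = teps t.
Proof. by case: (ueq_lift (repr_ucl t)). Qed.
Lemma udelta_cl t : udelta (ucl t) = tdelta t.
Proof. by case: (ueq_lift (repr_ucl t)). Qed.

Lemma udelta_in a : udelta (uin a) = ud a.
Proof. exact: udelta_cl. Qed.
Lemma udelta_d a : udelta (ud a) = 0.
Proof. exact: udelta_cl. Qed.
Lemma udeltaD x y : udelta (x + y) = udelta x + udelta y.
Proof.
elim/univW: x => x; elim/univW: y => y.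
by rewrite -uclD !udelta_cl.
Qed.
Lemma udeltaM x y : udelta (x * y) = udelta x * y + ueps x * udelta y.
Proof.
elim/univW: x => x; elim/univW: y => y.
by rewrite -uclM !udelta_cl ueps_cl.
Qed.
Lemma ueps_in a : ueps (uin a) = uin a.
Proof. exact: ueps_cl. Qed.
Lemma ueps_d a : ueps (ud a) = - ud a.
Proof. exact: ueps_cl. Qed.
Lemma uepsD x y : ueps (x + y) = ueps x + ueps y.
Proof.
by elim/univW: x => x; elim/univW: y => y; rewrite -uclD !ueps_cl.
Qed.
Lemma uepsM x y : ueps (x * y) = ueps x * ueps y.
Proof.
by elim/univW: x => x; elim/univW: y => y; rewrite -uclM !ueps_cl.
Qed.

(* Omega_u^k *)
Definition udeg (k : nat) (x : univ) : Prop :=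
  exists s : seq (A * (nat -> A)),
    x = \sum_(p <- s) uin p.1 * \prod_(i < k) ud (p.2 i).

Lemma udelta0 : udelta 0 = 0.
Proof. by rewrite -uin0 udelta_in -[in ud 0](scale0r (1 : A)) ud_scal. Qed.
Lemma ueps0 : ueps 0 = 0.
Proof. by rewrite -uin0 ueps_in. Qed.
Lemma udelta_prod k (a : nat -> A) : udelta (\prod_(i < k) ud (a i)) = 0.
Proof.
elim: k => [|k IH]; first by rewrite big_ord0 -uin1 udelta_in ud1.
by rewrite big_ord_recr udeltaM IH udelta_d mul0r mulr0 addr0.
Qed.
Lemma ueps_prod k (a : nat -> A) :
  ueps (\prod_(i < k) ud (a i)) = (-1) ^+ k * \prod_(i < k) ud (a i).
Proof.
elim: k => [|k IH]; first by rewrite big_ord0 mul1r -uin1 ueps_in.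
by rewrite !big_ord_recr /= uepsM IH ueps_d exprS mulrN !mulNr mul1r mulrA.
Qed.

Lemma udeg0 k : udeg k 0. Proof. by exists [::]; rewrite big_nil. Qed.
Lemma udegD k x y : udeg k x -> udeg k y -> udeg k (x + y).
Proof. by move=> [s ->] [t ->]; exists (s ++ t); rewrite big_cat. Qed.
Lemma udeg_sum k (I : Type) (r : seq I) (F : I -> univ) :
  (forall i, udeg k (F i)) -> udeg k (\sum_(i <- r) F i).
Proof.
move=> h; elim: r => [|i r IH]; first by rewrite big_nil; apply: udeg0.
by rewrite big_cons; apply: udegD.
Qed.
Lemma udeg_mono k a (b : nat -> A) :
  udeg k (uin a * \prod_(i < k) ud (b i)).
Proof. by exists [:: (a, b)]; rewrite big_seq1. Qed.
Lemma udeg_linl k a x : udeg k x -> udeg k (uin a * x).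
Proof.
move=> [s ->]; rewrite mulr_sumr; apply: udeg_sum => p.
by rewrite mulrA -uinM; apply: udeg_mono.
Qed.
Lemma udegN k x : udeg k x -> udeg k (- x).
Proof. by move=> h; rewrite -mulN1r -uin1 -uinN; apply: udeg_linl. Qed.
Lemma udegB k x y : udeg k x -> udeg k y -> udeg k (x - y).
Proof. by move=> h1 h2; apply/udegD/udegN. Qed.
Lemma udeg_in a : udeg 0 (uin a).
Proof. by have := udeg_mono 0 a (fun=> 0); rewrite big_ord0 mulr1. Qed.
Lemma udeg_rd k b x : udeg k x -> udeg k.+1 (x * ud b).
Proof.
move=> [s ->]; rewrite mulr_suml; apply: udeg_sum => p.
have := udeg_mono k.+1 p.1 (fun i => if (i < k)%N then p.2 i else b).
rewrite big_ord_recr /= ltnn -mulrA.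
by under eq_bigr => i _ do rewrite ltn_ord.
Qed.
Lemma udeg_d a : udeg 1 (ud a).
Proof. by have := udeg_rd a (udeg_in 1); rewrite uin1 mul1r. Qed.
Lemma udeg_rin k b x : udeg k x -> udeg k (x * uin b).
Proof.
elim: k x b => [|k IH] x b [s ->]; rewrite mulr_suml; apply: udeg_sum => p.
  by rewrite big_ord0 mulr1 -uinM; apply: udeg_in.
rewrite big_ord_recr /= -!mulrA.
have -> : ud (p.2 k) * uin b = ud (p.2 k * b) - uin (p.2 k) * ud b.
  by rewrite udM addrK.
rewrite !mulrBr !mulrA; apply: udegB; apply: udeg_rd; first exact: udeg_mono.
exact/IH/udeg_mono.
Qed.
Lemma udegM k l x y : udeg k x -> udeg l y -> udeg (k + l) (x * y).
Proof.
move=> hx [s ->]; rewrite mulr_sumr; apply: udeg_sum => p.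
elim: l => [|l IH]; first by rewrite big_ord0 mulr1 addn0; apply: udeg_rin.
by rewrite big_ord_recr /= addnS !mulrA; apply: udeg_rd; rewrite -mulrA.
Qed.
Lemma udelta_sum (I : Type) (r : seq I) (F : I -> univ) :
  udelta (\sum_(i <- r) F i) = \sum_(i <- r) udelta (F i).
Proof.
elim: r => [|i r IH]; first by rewrite !big_nil udelta0.
by rewrite !big_cons udeltaD IH.
Qed.
Lemma ueps_sum (I : Type) (r : seq I) (F : I -> univ) :
  ueps (\sum_(i <- r) F i) = \sum_(i <- r) ueps (F i).
Proof.
elim: r => [|i r IH]; first by rewrite !big_nil ueps0.
by rewrite !big_cons uepsD IH.
Qed.
Lemma udelta_mono k a (b : nat -> A) :
  udelta (uin a * \prod_(i < k) ud (b i)) = ud a * \prod_(i < k) ud (b i).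
Proof. by rewrite udeltaM udelta_prod mulr0 addr0 udelta_in. Qed.
Lemma udeg_delta k x : udeg k x -> udeg k.+1 (udelta x).
Proof.
move=> [s ->]; rewrite udelta_sum; apply: udeg_sum => p.
rewrite udelta_mono -[k.+1]add1n; apply: udegM; first exact: udeg_d.
by rewrite -[\prod_(i < k) _]mul1r -uin1; apply: udeg_mono.
Qed.
Lemma ueps_deg k x : udeg k x -> ueps x = (-1) ^+ k * x.
Proof.
move=> [s ->]; rewrite ueps_sum mulr_sumr; apply: eq_bigr => p _.
by rewrite uepsM ueps_in ueps_prod !mulrA commr_sign.
Qed.
Lemma udeltaK k x : udeg k x -> udelta (udelta x) = 0.
Proof.
move=> [s ->]; rewrite !udelta_sum big1 // => p _.
by rewrite udelta_mono udeltaM udelta_prod udelta_d mul0r mulr0 addr0.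
Qed.

End Universal.

(* A faithful representation of A and an operator D on a common invariant
   domain dt_dom; below dt_dom is a dense subspace of a Hilbert space.  When
   the commutators [D, a] are bounded, all the operators a0 [D, a1] ... [D, ak]
   are bounded, hence determined by their restriction to dt_dom. *)
Record diracTriple (C : fieldType) (A : algType C) := DiracTriple {
  dt_dom : lmodType C;
  dt_rep : A -> dt_dom -> dt_dom;
  dt_D : dt_dom -> dt_dom;
  dt_rep_linear : forall a, linear (dt_rep a);
  dt_repD : forall a b x, dt_rep (a + b) x = dt_rep a x + dt_rep b x;
  dt_repZ : forall (c : C) a x, dt_rep (c *: a) x = c *: dt_rep a x;
  dt_repM : forall a b x, dt_rep (a * b) x = dt_rep a (dt_rep b x);
  dt_rep1 : forall x, dt_rep 1 x = x;
  dt_rep_inj : forall a, (forall x, dt_rep a x = 0) -> a = 0;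
  dt_D_linear : linear dt_D
}.

Arguments dt_rep {C A} d a x.
Arguments dt_D {C A} d x.

Section Connes.
Variables (C : fieldType) (A : algType C) (X : diracTriple A).
Local Notation E := (dt_dom X).
Local Notation op := (E -> E).
Local Notation U := (univ A).

Definition op_rep (a : A) : op := dt_rep X a.
Definition op_comm (a : A) : op :=
  fun x => dt_D X (op_rep a x) - op_rep a (dt_D X x).

Fixpoint term_op (t : uterm A) : op :=
  match t with
  | UIn a => op_rep a
  | UDel a => op_comm a
  | UAdd x y => term_op x + term_op y
  | UMul x y => term_op x \o term_op y
  end.

Lemma op_rep_lin a c x y : op_rep a (c *: x + y) = c *: op_rep a x + op_rep a y.
Proof. exact: dt_rep_linear. Qed.
Lemma dt_D_lin c x y : dt_D X (c *: x + y) = c *: dt_D X x + dt_D X y.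
Proof. exact: dt_D_linear. Qed.
Lemma op_repDr a x y : op_rep a (x + y) = op_rep a x + op_rep a y.
Proof. by rewrite -[x]scale1r op_rep_lin !scale1r. Qed.
Lemma op_repDl a b x : op_rep (a + b) x = op_rep a x + op_rep b x.
Proof. exact: dt_repD. Qed.
Lemma op_rep0r a : op_rep a 0 = 0.
Proof. by apply: (@addrI _ (op_rep a 0)); rewrite -op_repDr !addr0. Qed.
Lemma op_repZr a c x : op_rep a (c *: x) = c *: op_rep a x.
Proof. by have := op_rep_lin a c x 0; rewrite op_rep0r !addr0. Qed.
Lemma op_repM a b x : op_rep (a * b) x = op_rep a (op_rep b x).
Proof. exact: dt_repM. Qed.
Lemma op_rep1 x : op_rep 1 x = x. Proof. exact: dt_rep1. Qed.
Lemma op_rep_scal c x : op_rep c%:A x = c *: x.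
Proof. by rewrite /op_rep dt_repZ dt_rep1. Qed.
Lemma op_rep0 x : op_rep 0 x = 0.
Proof. by rewrite -(scale0r (1 : A)) op_rep_scal scale0r. Qed.
Lemma op_repNr a x : op_rep a (- x) = - op_rep a x.
Proof. by rewrite -scaleN1r op_repZr scaleN1r. Qed.
Lemma dt_DD x y : dt_D X (x + y) = dt_D X x + dt_D X y.
Proof. by rewrite -[x]scale1r dt_D_lin !scale1r. Qed.
Lemma dt_D0 : dt_D X 0 = 0.
Proof. by apply: (@addrI _ (dt_D X 0)); rewrite -dt_DD !addr0. Qed.
Lemma dt_DZ c x : dt_D X (c *: x) = c *: dt_D X x.
Proof. by have := dt_D_lin c x 0; rewrite dt_D0 !addr0. Qed.

Lemma term_op_linear t c x y :
  term_op t (c *: x + y) = c *: term_op t x + term_op t y.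
Proof.
elim: t x y => [a|a|s IH1 t IH2|s IH1 t IH2] x y /=.
- exact: op_rep_lin.
- rewrite /op_comm op_rep_lin !dt_D_lin op_rep_lin scalerBr opprD.
  by rewrite addrACA.
- by rewrite /= !addrfctE IH1 IH2 scalerDr addrACA.
- by rewrite IH2 IH1.
Qed.
Lemma term_opD t x y : term_op t (x + y) = term_op t x + term_op t y.
Proof. by have := term_op_linear t 1 x y; rewrite !scale1r. Qed.

Lemma op_commDl a b x : op_comm (a + b) x = op_comm a x + op_comm b x.
Proof. by rewrite /op_comm !op_repDl dt_DD opprD addrACA. Qed.
Lemma op_commZ c a x : op_comm (c *: a) x = c *: op_comm a x.
Proof. by rewrite /op_comm /op_rep !dt_repZ dt_DZ scalerBr. Qed.
Lemma op_commM a b x :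
  op_comm (a * b) x = op_comm a (op_rep b x) + op_rep a (op_comm b x).
Proof.
by rewrite /op_comm !op_repM op_repDr op_repNr addrA subrK.
Qed.

Lemma term_op_ueq s t : ueq s t -> term_op s = term_op t.
Proof.
elim=> //=.
- by move=> x y z _ -> _ ->.
- by move=> x x' y y' _ -> _ ->.
- by move=> x x' y y' _ -> _ ->.
- by move=> x y z; rewrite addrA.
- by move=> x y; rewrite addrC.
- by move=> x; apply/funext => v; rewrite addrfctE op_rep0 add0r.
- move=> x; apply/funext => v; rewrite addrfctE /= op_rep0.
  by rewrite -scaleN1r op_rep_scal scaleN1r addNr.
- by move=> x; apply/funext => v /=; rewrite op_rep1.
- by move=> x; apply/funext => v /=; rewrite op_rep1.
- by move=> x y z; apply/funext => v; rewrite /= !addrfctE /= term_opD.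
- by move=> a b; apply/funext => v; rewrite addrfctE op_repDl.
- by move=> a b; apply/funext => v; rewrite /= op_repM.
- by move=> a b; apply/funext => v; rewrite addrfctE op_commDl.
- by move=> c a; apply/funext => v; rewrite /= op_rep_scal op_commZ.
- by move=> a b; apply/funext => v; rewrite addrfctE /= op_commM.
Qed.

(* Pi(a0 da1 ... dak) = a0 [D, a1] ... [D, ak] *)
Definition PiU (x : U) : op := term_op (repr x).

Lemma PiU_cl t : PiU (ucl t) = term_op t.
Proof. exact/term_op_ueq/repr_ucl. Qed.
Lemma PiU_in a : PiU (uin a) = op_rep a.
Proof. exact: PiU_cl. Qed.
Lemma PiU_d a : PiU (ud a) = op_comm a.
Proof. exact: PiU_cl. Qed.
Lemma PiUD x y : PiU (x + y) = PiU x + PiU y.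
Proof.
by elim/univW: x => x; elim/univW: y => y; rewrite -uclD !PiU_cl.
Qed.
Lemma PiUM x y : PiU (x * y) = PiU x \o PiU y.
Proof.
by elim/univW: x => x; elim/univW: y => y; rewrite -uclM !PiU_cl.
Qed.
Lemma PiU0 : PiU 0 = 0.
Proof. by apply: (@addrI _ (PiU 0)); rewrite -PiUD !addr0. Qed.
Lemma PiUN x : PiU (- x) = - PiU x.
Proof. by apply/eqP; rewrite -addr_eq0 -PiUD addNr PiU0. Qed.
Lemma PiUB x y : PiU (x - y) = PiU x - PiU y.
Proof. by rewrite PiUD PiUN. Qed.
Lemma PiU_linear x c u v : PiU x (c *: u + v) = c *: PiU x u + PiU x v.
Proof. by elim/univW: x => x; rewrite PiU_cl term_op_linear. Qed.
Lemma PiU_0 x : PiU x 0 = 0.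
Proof. by have := PiU_linear x (-1) 0 0; rewrite scaler0 addr0 scaleN1r addNr. Qed.

(* Pi(Omega_u^k) *)
Definition opforms (k : nat) : {pred op} :=
  fun T => `[< exists2 w : U, udeg k w & PiU w = T >].

(* J_0^k *)
Definition J0 (k : nat) : set U := [set w | udeg k w /\ PiU w = 0].

(* Pi(delta J_0^(k-1)), where J_0^(-1) = 0 *)
Definition junk_set (k : nat) : set op :=
  match k with
  | 0 => [set 0]
  | k'.+1 => [set PiU (udelta w) | w in J0 k']
  end.

Lemma opforms_closed k : zmod_closed (opforms k).
Proof.
split; first by apply/asboolP; exists 0; [exact: udeg0 | rewrite PiU0].
move=> S T /asboolP [w hw <-] /asboolP [v hv <-]; apply/asboolP.
by exists (w - v); [exact: udegB | rewrite PiUB].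
Qed.
HB.instance Definition _ k := GRing.isZmodClosed.Build op (opforms k)
  (opforms_closed k).

Record opform (k : nat) := OpForm { opval :> op; _ : opval \in opforms k }.
HB.instance Definition _ k := [isSub for @opval k].
HB.instance Definition _ k := [Choice of opform k by <:].
HB.instance Definition _ k := [SubChoice_isSubZmodule of opform k by <:].

Definition junk (k : nat) : {pred opform k} :=
  fun T => `[< junk_set k (opval T) >].
Arguments junk : clear implicits.

Lemma udeltaN (x : U) : udelta (- x) = - udelta x.
Proof. by apply/eqP; rewrite -addr_eq0 -udeltaD addNr udelta0. Qed.

Lemma junk_closed k : zmod_closed (junk k).
Proof.
case: k => [|k]; split.
- exact/asboolP.
- move=> S T /asboolP /= hS /asboolP /= hT; apply/asboolP => /=.
  by rewrite hS hT subrr.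
- apply/asboolP; exists 0; last by rewrite udelta0 PiU0.
  by split; [exact: udeg0 | exact: PiU0].
- move=> S T /asboolP /= [w [w1 w2] hw] /asboolP [v [v1 v2] hv].
  apply/asboolP; exists (w - v); last first.
    by rewrite udeltaD udeltaN PiUB hw hv.
  by split; [exact: udegB | rewrite PiUB w2 v2 subrr].
Qed.
HB.instance Definition _ k := GRing.isZmodClosed.Build (opform k) (junk k)
  (junk_closed k).

(* Omega^k(A) = Pi(Omega_u^k) / Pi(delta J_0^(k-1)) *)
Definition Omega (k : nat) := Quotient.quot (junk k).
HB.instance Definition _ k := GRing.Zmodule.on (Omega k).

(* the class of an operator in Pi(Omega_u^k) (and 0 for other operators) *)
Definition opcls (k : nat) (T : op) : Omega k := \pi_(Omega k) (insubd 0 T).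

Definition om_lact k (a : A) (x : Omega k) : Omega k :=
  opcls k (op_rep a \o opval (repr x)).
Definition om_ract k (x : Omega k) (a : A) : Omega k :=
  opcls k (opval (repr x) \o op_rep a).
Definition om_wedge k l (x : Omega k) (y : Omega l) : Omega (k + l)%N :=
  opcls (k + l) (opval (repr x) \o opval (repr y)).
(* the universal form lifting a representative of x *)
Definition om_lift k (x : Omega k) : U :=
  xget 0 [set w | udeg k w /\ PiU w = opval (repr x)].
Definition om_diff k (x : Omega k) : Omega k.+1 :=
  opcls k.+1 (PiU (udelta (om_lift x))).
Definition om_deg0 (a : A) : Omega 0 := opcls 0 (op_rep a).

Definition ucls k (w : U) : Omega k := opcls k (PiU w).

Lemma opval_insubd k w : udeg k w -> opval (insubd 0 (PiU w) : opform k) = PiU w.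
Proof.
by move=> h; rewrite -[LHS]/(val _) insubdK //; apply/asboolP; exists w.
Qed.

Lemma ucls_eqP k w v : udeg k w -> udeg k v ->
  ucls k w = ucls k v <-> junk_set k (PiU w - PiU v).
Proof.
move=> hw hv.
have e : opval (insubd 0 (PiU w) - insubd 0 (PiU v) : opform k) = PiU w - PiU v.
  by rewrite -[LHS]/(val _) raddfB /= !opval_insubd.
split.
  move=> /eqP; rewrite /ucls /opcls -Quotient.idealrBE => /asboolP.
  by rewrite e.
move=> h; apply/eqP; rewrite /ucls /opcls -Quotient.idealrBE.
by apply/asboolP; rewrite e.
Qed.

Lemma uclsW k (P : Omega k -> Prop) :
  (forall w, udeg k w -> P (ucls k w)) -> forall x, P x.
Proof.
move=> h x; rewrite -[x]reprK.
case: (repr x) => T hT; have /asboolP [w hw e] := hT.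
suff -> : OpForm hT = insubd 0 (PiU w) by exact: h.
by apply: val_inj; rewrite /= opval_insubd.
Qed.

Lemma ucls_repr k w : udeg k w -> exists v, [/\ udeg k v,
  PiU v = opval (repr (ucls k w)) & junk_set k (PiU v - PiU w)].
Proof.
move=> hw; case E: (repr _) => [T hT]; have /asboolP [v hv e] := hT.
exists v; split=> //; apply/ucls_eqP => //.
rewrite -[RHS]reprK E /ucls /opcls; congr (\pi_(Omega k) _).
by apply: val_inj; rewrite /= opval_insubd.
Qed.

Lemma uclsD k w v : udeg k w -> udeg k v ->
  ucls k (w + v) = ucls k w + ucls k v.
Proof.
move=> hw hv; rewrite /ucls /opcls.
rewrite -[RHS](raddfD (\pi_(Omega k))).
congr (\pi_(Omega k) _); apply: val_inj; rewrite raddfD /= !opval_insubd //.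
  by rewrite PiUD.
exact: udegD.
Qed.

Lemma junk_succ k w : udeg k w -> PiU w = 0 -> junk_set k.+1 (PiU (udelta w)).
Proof. by move=> h1 h2; exists w. Qed.

Lemma junkP k T : junk_set k T -> exists w,
  [/\ udeg k w, PiU w = T & w = 0 \/
     exists k' v, [/\ k = k'.+1, udeg k' v, PiU v = 0 & w = udelta v]].
Proof.
case: k => [|k] /=.
  by move=> ->; exists 0; split; [exact: udeg0|exact: PiU0|left].
move=> [v [h1 h2] <-]; exists (udelta v); split=> //; first exact: udeg_delta.
by right; exists k, v.
Qed.

Lemma junk0 k : junk_set k 0.
Proof.
case: k => // k; exists 0; last by rewrite udelta0 PiU0.
by split; [exact: udeg0 | exact: PiU0].
Qed.

Lemma PiU_eps0 k w : udeg k w -> PiU w = 0 -> PiU (ueps w) = 0.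
Proof.
move=> h e; rewrite (ueps_deg h) PiUM e; apply/funext => v /=.
exact: PiU_0.
Qed.

Lemma comp0op (T : op) : (0 : op) \o T = 0. Proof. by []. Qed.
Lemma PiU_comp0 w : PiU w \o (0 : op) = 0.
Proof. by apply/funext => v; rewrite /= PiU_0. Qed.


Lemma junkD k S T : junk_set k S -> junk_set k T -> junk_set k (S + T).
Proof.
case: k => [|k] /=; first by move=> -> ->; rewrite addr0.
move=> [w [w1 w2] <-] [v [v1 v2] <-]; exists (w + v); last first.
  by rewrite udeltaD PiUD.
by split; [exact: udegD | rewrite PiUD w2 v2 addr0].
Qed.

Lemma ueps_sgn l (v : U) : udeg l v -> ueps v = v \/ ueps v = - v.
Proof.
move=> h; rewrite (ueps_deg h) -signr_odd.
by case: (odd l); [right; rewrite expr1 mulN1r | left; rewrite expr0 mul1r].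
Qed.

Lemma uepsN (v : U) : ueps (- v) = - ueps v.
Proof. by apply/eqP; rewrite -addr_eq0 -uepsD addNr ueps0. Qed.

Lemma junk_mulr k l x v : udeg l v -> junk_set k (PiU x) ->
  junk_set (k + l) (PiU (x * v)).
Proof.
move=> hv /junkP [w [hw e h]]; rewrite PiUM -e.
case: h => [->|]; first by rewrite PiU0 comp0op; apply: junk0.
move=> [k' [u [-> hu u0 ->]]]; exists (u * v); first split.
- exact: udegM.
- by rewrite PiUM u0 comp0op.
- rewrite udeltaM PiUD [PiU (ueps u * _)]PiUM (PiU_eps0 hu u0) comp0op.
  by rewrite addr0 PiUM.
Qed.

Lemma junk_mull k l x v : udeg l v -> junk_set k (PiU x) ->
  junk_set (l + k) (PiU (v * x)).
Proof.
move=> hv /junkP [w [hw e h]]; rewrite PiUM -e.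
case: h => [->|]; first by rewrite PiU0 PiU_comp0; apply: junk0.
move=> [k' [u [-> hu u0 ->]]]; rewrite addnS.
have [h1 h2] : udeg l (ueps v) /\ ueps (ueps v) = v.
  case: (ueps_sgn hv) => eq; first by rewrite !eq.
  by rewrite eq uepsN eq opprK; split => //; apply: udegN.
exists (ueps v * u); first split.
- exact: udegM.
- by rewrite PiUM u0 PiU_comp0.
- by rewrite udeltaM PiUD [PiU (_ * u)]PiUM u0 PiU_comp0 add0r h2 PiUM.
Qed.

Lemma wedge_ucls k l w v : udeg k w -> udeg l v ->
  om_wedge (ucls k w) (ucls l v) = ucls (k + l) (w * v).
Proof.
move=> hw hv; rewrite /om_wedge.
have [w' [hw' <- jw]] := ucls_repr hw; have [v' [hv' <- jv]] := ucls_repr hv.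
rewrite -PiUM -/(ucls _ _); apply/ucls_eqP; try exact: udegM.
rewrite -PiUB (_ : _ - _ = (w' - w) * v' + w * (v' - v)); last first.
  by rewrite mulrBl mulrBr addrA subrK.
rewrite PiUD; apply: junkD.
- by apply: junk_mulr => //; rewrite PiUB.
- by apply: junk_mull => //; rewrite PiUB.
Qed.

Lemma lact_ucls k a w : udeg k w -> om_lact a (ucls k w) = ucls k (uin a * w).
Proof.
move=> hw; rewrite /om_lact.
have [w' [hw' <- jw]] := ucls_repr hw.
rewrite -PiU_in -PiUM -/(ucls _ _); apply/ucls_eqP; try exact: udeg_linl.
rewrite -PiUB -mulrBr; apply: (@junk_mull k 0); first exact: udeg_in.
by rewrite PiUB.
Qed.

Lemma ract_ucls k a w : udeg k w -> om_ract (ucls k w) a = ucls k (w * uin a).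
Proof.
move=> hw; rewrite /om_ract.
have [w' [hw' <- jw]] := ucls_repr hw.
rewrite -PiU_in -PiUM -/(ucls _ _); apply/ucls_eqP; try exact: udeg_rin.
rewrite -PiUB -mulrBl -{1}[k]addn0; apply: junk_mulr; first exact: udeg_in.
by rewrite PiUB.
Qed.

Lemma diff_ucls k w : udeg k w -> om_diff (ucls k w) = ucls k.+1 (udelta w).
Proof.
move=> hw; have [w' [hw' ew jw]] := ucls_repr hw; rewrite /om_diff.
have [hu eu] : [set u | udeg k u /\ PiU u = opval (repr (ucls k w))]
    (om_lift (ucls k w)) by apply: (@xgetI _ _ _ w').
set u := om_lift _ in hu eu *; rewrite -/(ucls _ _).
apply/ucls_eqP; try exact: udeg_delta.
move: jw; rewrite ew -eu -PiUB => /junkP [v [hv ev hv0]].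
have dv : udelta v = 0.
  case: hv0 => [->|[k' [t [_ ht _ ->]]]]; first exact: udelta0.
  exact: udeltaK ht.
rewrite -PiUB; have -> : udelta u - udelta w = udelta (u - w - v).
  by rewrite !udeltaD !udeltaN dv subr0.
exists (u - w - v) => //; split; first by do 2?apply: udegB.
by rewrite PiUB ev subrr.
Qed.

Lemma deg0_ucls a : om_deg0 a = ucls 0 (uin a).
Proof. by rewrite /ucls PiU_in. Qed.

Fact om_lactDl k a b (x : Omega k) :
  om_lact (a + b) x = om_lact a x + om_lact b x.
Proof.
elim/uclsW: x => w hw; rewrite !lact_ucls // uinD mulrDl uclsD //;
  exact: udeg_linl.
Qed.
Fact om_lactDr k a (x y : Omega k) :
  om_lact a (x + y) = om_lact a x + om_lact a y.
Proof.
elim/uclsW: x => w hw; elim/uclsW: y => v hv.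
rewrite -uclsD // !lact_ucls //; last exact: udegD.
by rewrite mulrDr uclsD //; exact: udeg_linl.
Qed.
Fact om_ractDl k (x y : Omega k) a :
  om_ract (x + y) a = om_ract x a + om_ract y a.
Proof.
elim/uclsW: x => w hw; elim/uclsW: y => v hv.
rewrite -uclsD // !ract_ucls //; last exact: udegD.
by rewrite mulrDl uclsD //; exact: udeg_rin.
Qed.
Fact om_ractDr k (x : Omega k) a b :
  om_ract x (a + b) = om_ract x a + om_ract x b.
Proof.
elim/uclsW: x => w hw; rewrite !ract_ucls // uinD mulrDr uclsD //;
  exact: udeg_rin.
Qed.
Fact om_lact1 k (x : Omega k) : om_lact 1 x = x.
Proof. by elim/uclsW: x => w hw; rewrite lact_ucls // uin1 mul1r. Qed.
Fact om_ract1 k (x : Omega k) : om_ract x 1 = x.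
Proof. by elim/uclsW: x => w hw; rewrite ract_ucls // uin1 mulr1. Qed.
Fact om_lactM k a b (x : Omega k) : om_lact (a * b) x = om_lact a (om_lact b x).
Proof.
elim/uclsW: x => w hw; rewrite !lact_ucls //; last exact: udeg_linl.
by rewrite uinM mulrA.
Qed.
Fact om_ractM k (x : Omega k) a b : om_ract x (a * b) = om_ract (om_ract x a) b.
Proof.
elim/uclsW: x => w hw; rewrite !ract_ucls //; last exact: udeg_rin.
by rewrite uinM mulrA.
Qed.
Fact om_lractA k a (x : Omega k) b :
  om_ract (om_lact a x) b = om_lact a (om_ract x b).
Proof.
elim/uclsW: x => w hw; rewrite lact_ucls // !ract_ucls //; last first.
  exact: udeg_linl.
by rewrite lact_ucls ?mulrA //; exact: udeg_rin.
Qed.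
HB.instance Definition _ k := isBimodule.Build A (Omega k)
  (@om_lactDl k) (@om_lactDr k) (@om_ractDl k) (@om_ractDr k)
  (@om_lact1 k) (@om_ract1 k) (@om_lactM k) (@om_ractM k) (@om_lractA k).

Definition connes_precalc : preCalculus A :=
  @PreCalculus A (fun k => Omega k) om_wedge om_diff om_deg0.

Local Notation W := connes_precalc.

Lemma cast_ucls k l (e : k = l) w :
  @cast_deg A W k l e (ucls k w) = ucls l w.
Proof. by case: l / e. Qed.

Lemma ucls_sum k (I : Type) (r : seq I) (F : I -> U) :
  (forall i, udeg k (F i)) ->
  ucls k (\sum_(i <- r) F i) = \sum_(i <- r) ucls k (F i).
Proof.
move=> h; elim: r => [|i r IH].
  rewrite !big_nil; apply: (@addrI _ (ucls k 0)).
  by rewrite -uclsD ?addr0 //; exact: udeg0.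
by rewrite !big_cons uclsD ?IH //; apply: udeg_sum.
Qed.

Lemma udeg_prod k (a : nat -> A) : udeg k (\prod_(i < k) ud (a i)).
Proof. by rewrite -[\prod_(i < k) _]mul1r -uin1; apply: udeg_mono. Qed.

Lemma exact_monomial_ucls k (a : nat -> A) :
  exact_monomial W k a = ucls k (\prod_(i < k) ud (a i)).
Proof.
elim: k a => [|k IH] a /=; first by rewrite big_ord0 deg0_ucls.
rewrite IH deg0_ucls (diff_ucls (udeg_in _)) udelta_in.
by rewrite (wedge_ucls (udeg_d (a 0%N)) (udeg_prod k (fun i => a i.+1))) big_ord_recl.
Qed.

Theorem connes_precalcP : isDiffCalculus connes_precalc.
Proof.
split.
- move=> k l x x' y; elim/uclsW: x => x hx; elim/uclsW: x' => x' hx'.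
  elim/uclsW: y => y hy; rewrite -uclsD //= !wedge_ucls ?mulrDl ?uclsD //;
    by [exact: udegM | exact: udegD].
- move=> k l x y y'; elim/uclsW: x => x hx; elim/uclsW: y' => y' hy'.
  elim/uclsW: y => y hy; rewrite -uclsD //= !wedge_ucls ?mulrDr ?uclsD //;
    by [exact: udegM | exact: udegD].
- move=> k l m x y z; elim/uclsW: x => x hx; elim/uclsW: y => y hy.
  elim/uclsW: z => z hz; rewrite /= !wedge_ucls ?cast_ucls ?mulrA //;
    exact: udegM.
- have inj : injective om_deg0.
    move=> a b; rewrite !deg0_ucls => /ucls_eqP h; apply/eqP.
    rewrite -subr_eq0; apply/eqP/(@dt_rep_inj _ _ X) => v.
    have := h (udeg_in a) (udeg_in b); rewrite /= -PiUB -uinN -uinD PiU_in.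
    by move=> /(congr1 (@^~ v)).
  have sur (x : Omega 0) : exists a, om_deg0 a = x.
    elim/uclsW: x => x [s ->]; exists (\sum_(p <- s) p.1).
    rewrite deg0_ucls; congr ucls; elim: s => [|p s IH].
      by rewrite !big_nil.
    by rewrite !big_cons uinD IH big_ord0 mulr1.
  have [g hg] := choice sur; exists g => // a; exact/inj/hg.
- move=> a b /=; rewrite !deg0_ucls uinD uclsD //; exact: udeg_in.
- move=> a b /=; rewrite !deg0_ucls wedge_ucls ?uinM //; exact: udeg_in.
- move=> k a x; elim/uclsW: x => x hx /=.
  by rewrite deg0_ucls (wedge_ucls (udeg_in a) hx) [RHS]lact_ucls.
- move=> k x a; elim/uclsW: x => x hx /=.
  by rewrite deg0_ucls (wedge_ucls hx (udeg_in a)) cast_ucls [RHS]ract_ucls.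
- move=> k c x; elim/uclsW: x => x hx.
  rewrite [LHS]lact_ucls // [RHS]ract_ucls //; apply/ucls_eqP.
  + exact: udeg_linl.
  + exact: udeg_rin.
  + rewrite !PiUM (_ : _ - _ = 0); first exact: junk0.
    apply/funext => v /=; rewrite !PiU_in.
    have := PiU_linear x c v 0; rewrite PiU_0 !addr0 => e.
    by rewrite /= -[LHS]/(op_rep _ _ - PiU x (op_rep _ v)) !op_rep_scal e subrr.
- move=> k x y; elim/uclsW: x => x hx; elim/uclsW: y => y hy /=.
  rewrite -uclsD // !diff_ucls ?udeltaD ?uclsD //;
    by [exact: udeg_delta|exact: udegD].
- move=> k c x; elim/uclsW: x => x hx /=.
  rewrite [lact _ _]lact_ucls // !diff_ucls //; last exact: udeg_linl.
  rewrite [RHS]lact_ucls; last exact: udeg_delta.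
  by rewrite udeltaM udelta_in ud_scal mul0r add0r ueps_in.
- move=> k x; elim/uclsW: x => x hx /=; rewrite !diff_ucls ?(udeltaK hx) //.
    by apply: (@addrI _ (ucls k.+2 0)); rewrite -uclsD ?addr0 //; exact: udeg0.
  exact: udeg_delta.
- move=> k l x y; elim/uclsW: x => x hx; elim/uclsW: y => y hy /=.
  have hdx := udeg_delta hx; have hdy := udeg_delta hy.
  rewrite (wedge_ucls hx hy) (diff_ucls (udegM hx hy)) (diff_ucls hx).
  rewrite (diff_ucls hy) (wedge_ucls hdx hy) (wedge_ucls hx hdy).
  rewrite [lact _ _]lact_ucls ?cast_ucls; last exact: udegM.
  have e : uin ((-1) ^+ k) = (-1) ^+ k :> U.
    elim: k {x hx hdx} => [|k IH]; first by rewrite !expr0.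
    by rewrite !exprS uinM IH uinN.
  rewrite e mulrA -(ueps_deg hx) udeltaM; apply: uclsD.
    exact: (udegM hdx hy).
  rewrite -addnS; apply: udegM => //.
  by case: (ueps_sgn hx) => -> //; apply: udegN.
- move=> k x; elim/uclsW: x => x [s ->]; exists s.
  rewrite ucls_sum; last by move=> p; apply: udeg_mono.
  apply: eq_bigr => p _; rewrite exact_monomial_ucls [RHS]lact_ucls //.
  exact: udeg_prod.
Qed.

Definition connes_calculus : diffCalculus A := DiffCalculus connes_precalcP.

End Connes.

Arguments opforms {C A} X k T.
Arguments opcls {C A} X k T.

(* The norm and completeness are spelled out because completeNormedModType and
   algType have no common extension in the hierarchy. *)
HB.mixin Record isCStarAlgebra (R : realType) A of GRing.Algebra R[i] A := {
  cnorm : A -> R;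
  star : A -> A;
  cnorm_eq0 : forall x, cnorm x = 0 -> x = 0;
  cnormD : forall x y, cnorm (x + y) <= cnorm x + cnorm y;
  cnormZ : forall (c : R[i]) x, (cnorm (c *: x))%:C = `|c| * (cnorm x)%:C;
  cnormM : forall x y, cnorm (x * y) <= cnorm x * cnorm y;
  cnorm_complete : forall u : nat -> A,
    (forall e, 0 < e -> exists N, forall p q, (N <= p)%N -> (N <= q)%N ->
      cnorm (u p - u q) < e) ->
    exists l, forall e, 0 < e -> exists N, forall p, (N <= p)%N ->
      cnorm (u p - l) < e;
  starD : {morph star : x y / x + y};
  starZ : forall (c : R[i]) x, star (c *: x) = c^* *: star x;
  starM : forall x y, star (x * y) = star y * star x;
  starK : involutive star;
  cnorm_star : forall x, cnorm (star x * x) = cnorm x ^+ 2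
}.
#[short(type="cstarAlgType")]
HB.structure Definition CStarAlgebra (R : realType) :=
  {A of isCStarAlgebra R A & GRing.Algebra R[i] A}.

Inductive star_gen (R : realType) (n : nat) (A : cstarAlgType R)
    (S : 'I_n -> A) : A -> Prop :=
| sg_gen i : star_gen S (S i)
| sg_one : star_gen S 1
| sg_star x : star_gen S x -> star_gen S (star x)
| sg_add x y : star_gen S x -> star_gen S y -> star_gen S (x + y)
| sg_mul x y : star_gen S x -> star_gen S y -> star_gen S (x * y)
| sg_scale (c : R[i]) x : star_gen S x -> star_gen S (c *: x).

(* A C*-algebra generated by n isometries: the *-subalgebra generated by the
   isometries is dense. *)
Record isometryAlgebra (R : realType) (n : nat) := IsometryAlgebra {
  ia_alg :> cstarAlgType R;
  ia_S : 'I_n -> ia_alg;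
  ia_isometry : forall i, star (ia_S i) * ia_S i = 1;
  ia_dense : forall (x : ia_alg) (e : R), 0 < e ->
    exists2 y, star_gen ia_S y & cnorm (x - y) < e
}.

Section PolynomialAlgebra.
Variables (R : realType) (n : nat) (A : isometryAlgebra R n).

Definition star_alg : {pred A} := fun x => `[< star_gen (@ia_S R n A) x >].

Lemma star_alg_closed : subalg_closed star_alg.
Proof.
split.
- exact/asboolP/sg_one.
- move=> c x y /asboolP hx /asboolP hy; apply/asboolP.
  by apply: sg_add => //; apply: sg_scale.
- by move=> x y /asboolP hx /asboolP hy; apply/asboolP; apply: sg_mul.
Qed.
HB.instance Definition _ := GRing.isSubalgClosed.Build R[i] A star_alg
  star_alg_closed.

(* the dense *-subalgebra generated by the isometries *)
Record polyalg := PolyAlg { pval :> A; _ : pval \in star_alg }.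
HB.instance Definition _ := [isSub for pval].
HB.instance Definition _ := [Choice of polyalg by <:].
HB.instance Definition _ := [SubChoice_isSubAlgebra of polyalg by <:].

Lemma gen_in i : ia_S A i \in star_alg.
Proof. exact/asboolP/sg_gen. Qed.
Lemma gen_star_in i : star (ia_S A i) \in star_alg.
Proof. exact/asboolP/sg_star/sg_gen. Qed.

Definition gen (i : 'I_n) : polyalg := PolyAlg (gen_in i).
Definition gen_star (i : 'I_n) : polyalg := PolyAlg (gen_star_in i).

Record derivations := Derivations {
  del :> 'I_n -> polyalg -> polyalg;
  del_linear : forall i, linear (del i);
  delM : forall i a b, del i (a * b) = del i a * b + a * del i b;
  del_gen : forall i j, del i (gen j) = (i == j)%:R *: gen i;
  del_gen_star : forall i j, del i (gen_star j) = - ((i == j)%:R *: gen_star j)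
}.

Record faithfulState := FaithfulState {
  state :> {scalar A};
  state_ge0 : forall a, 0 <= state (star a * a);
  state1 : state 1 = 1;
  state_faithful : forall a, state (star a * a) = 0 -> a = 0
}.

(* L^2(A, tau): a Hilbert space (inner product linear on the right) with a
   dense copy of A on which the inner product is tau(a^* b), and with the
   continuous extensions of the left multiplications. *)
Record gns (tau : faithfulState) := Gns {
  gns_space :> completeNormedModType R[i];
  gns_ip : gns_space -> gns_space -> R[i];
  gns_ip_linear : forall x, scalar (gns_ip x);
  gns_ip_conj : forall x y, gns_ip y x = (gns_ip x y)^*;
  gns_ip_norm : forall x, `|x| ^+ 2 = gns_ip x x;
  gns_vec : A -> gns_space;
  gns_vec_linear : linear gns_vec;
  gns_vec_ip : forall a b, gns_ip (gns_vec a) (gns_vec b) = tau (star a * b);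
  gns_vec_dense : dense (range gns_vec);
  gns_rep : A -> gns_space -> gns_space;
  gns_rep_linear : forall a, linear (gns_rep a);
  gns_rep_continuous : forall a, continuous (gns_rep a);
  gns_rep_vec : forall a b, gns_rep a (gns_vec b) = gns_vec (a * b)
}.

End PolynomialAlgebra.
Arguments gns_ip {R n A tau} g x y.
Arguments gns_vec {R n A tau} g a.
Arguments gns_rep {R n A tau} g a x.

Record gammaMatrices (R : realType) (n : nat) := GammaMatrices {
  gamma :> 'I_n -> 'M[R[i]]_(2 ^ n./2);
  gamma_sq : forall i, gamma i *m gamma i = 1%:M;
  gamma_anti : forall i j, i != j ->
    gamma i *m gamma j = - (gamma j *m gamma i)
}.

Section Canonical.
Variables (R : realType) (n : nat) (A : isometryAlgebra R n).
Variables (partial : derivations A) (tau : faithfulState A) (L : gns tau).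
Variable gam : gammaMatrices R n.
Local Notation N := (2 ^ n./2)%N.
Local Notation P := (polyalg A).

(* L^2(A, tau) (x) C^N, as N-tuples of vectors of L^2(A, tau) *)
Definition hilb := {ffun 'I_N -> L}.
HB.instance Definition _ := GRing.Lmodule.on hilb.

Definition hvec (f : {ffun 'I_N -> P}) : hilb :=
  [ffun s => gns_vec L (pval (f s))].

Lemma hvec_linear : linear hvec.
Proof.
move=> c f h; apply/ffunP => s; rewrite !ffunE /=.
exact: (gns_vec_linear L).
Qed.

(* The domain of D: the image of P (x) C^N, dense in L^2(A, tau) (x) C^N; P
   embeds because tau is faithful (hdom_of_inj). *)
Definition dom_pred : {pred hilb} := fun x => `[< range hvec x >].

Lemma dom_closed : submod_closed dom_pred.
Proof.
have h0 : hvec 0 = 0.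
  by have := hvec_linear (-1) 0 0; rewrite scaler0 addr0 scaleN1r addNr.
split; first by apply/asboolP; exists 0.
move=> c x y /asboolP [f _ <-] /asboolP [h _ <-]; apply/asboolP.
by exists (c *: f + h) => //; rewrite hvec_linear.
Qed.
HB.instance Definition _ := GRing.isSubmodClosed.Build R[i] hilb dom_pred
  dom_closed.

Record hdom := HDom { hval :> hilb; _ : hval \in dom_pred }.
HB.instance Definition _ := [isSub for hval].
HB.instance Definition _ := [Choice of hdom by <:].
HB.instance Definition _ := [SubChoice_isSubLmodule of hdom by <:].

Lemma hvec_in f : hvec f \in dom_pred.
Proof. by apply/asboolP; exists f. Qed.
Definition hdom_of (f : {ffun 'I_N -> P}) : hdom := HDom (hvec_in f).

Lemma hdom_ofE (x : hdom) : exists f, hdom_of f = x.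
Proof.
case: x => x hx; have /asboolP [f _ e] := hx.
by exists f; apply: val_inj.
Qed.

Definition coord (x : hdom) : {ffun 'I_N -> P} := sval (cid (hdom_ofE x)).

Lemma coordK x : hdom_of (coord x) = x.
Proof. exact: svalP (cid (hdom_ofE x)). Qed.

Lemma hdom_of_inj : injective hdom_of.
Proof.
move=> f h /(congr1 val) /= /ffunP e; apply/ffunP => s.
apply: val_inj; apply/eqP; rewrite -subr_eq0; apply/eqP.
apply: (@state_faithful _ _ _ tau).
rewrite -(gns_vec_ip L); set v := gns_vec L _.
have -> : v = 0.
  rewrite /v -scaleN1r addrC (gns_vec_linear L).
  by have := e s; rewrite !ffunE => ->; rewrite scaleN1r addNr.
have := @gns_ip_linear _ _ _ _ L 0 (-1) 0 0.
by rewrite scaler0 addr0 mulN1r addNr.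
Qed.

Lemma hdom_ofK : cancel hdom_of coord.
Proof. by move=> f; apply: hdom_of_inj; rewrite coordK. Qed.

Lemma hdom_of_linear : linear hdom_of.
Proof. by move=> c f h; apply: val_inj; rewrite /= hvec_linear. Qed.

Lemma coord_linear : linear coord.
Proof.
move=> c x y; apply: hdom_of_inj.
by rewrite hdom_of_linear !coordK.
Qed.

(* a (x) 1 *)
Lemma hrep_in (a : P) (x : hdom) :
  [ffun s => gns_rep L (pval a) (hval x s)] \in dom_pred.
Proof.
apply/asboolP; exists [ffun s => a * coord x s] => //.
apply/ffunP => s; rewrite !ffunE /= -(gns_rep_vec L) -{2}(coordK x).
by rewrite !ffunE.
Qed.
Definition hrep (a : P) (x : hdom) : hdom := HDom (hrep_in a x).

(* D = \sum_i del_i (x) gamma_i, where coord x is the element of P (x) C^N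
   that x comes from *)
Definition hdirac (x : hdom) : hdom :=
  hdom_of [ffun s => \sum_(i < n) \sum_(t < N) gam i s t *: partial i (coord x t)].

Lemma gns_sum (I : Type) (r : seq I) (c : I -> R[i]) (F : I -> P) :
  gns_vec L (pval (\sum_(t <- r) c t *: F t)) =
  \sum_(t <- r) c t *: gns_vec L (pval (F t)).
Proof.
elim: r => [|t r IH]; last by rewrite !big_cons (gns_vec_linear L) IH.
rewrite !big_nil /=; have := gns_vec_linear L (-1) 0 0.
by rewrite scaler0 addr0 scaleN1r addNr.
Qed.

(* 1 (x) gamma_i *)
Lemma hgamma_in (i : 'I_n) (x : hdom) :
  [ffun s => \sum_(t < N) gam i s t *: hval x t] \in dom_pred.
Proof.
apply/asboolP; exists [ffun s => \sum_(t < N) gam i s t *: coord x t] => //.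
apply/ffunP => s; rewrite !ffunE /= gns_sum; apply: eq_bigr => t _.
by rewrite -{2}(coordK x) !ffunE.
Qed.
Definition hgamma (i : 'I_n) (x : hdom) : hdom := HDom (hgamma_in i x).

Lemma hgammaE i f :
  hgamma i (hdom_of f) = hdom_of [ffun s => \sum_(t < N) gam i s t *: f t].
Proof.
apply: val_inj; apply/ffunP => s; rewrite /= !ffunE gns_sum.
by apply: eq_bigr => t _; rewrite !ffunE.
Qed.

Lemma hrepE a f : hrep a (hdom_of f) = hdom_of [ffun s => a * f s].
Proof.
by apply: val_inj; apply/ffunP => s; rewrite /= !ffunE /= (gns_rep_vec L).
Qed.

Lemma hdiracE f : hdirac (hdom_of f) =
  hdom_of [ffun s => \sum_(i < n) \sum_(t < N) gam i s t *: partial i (f t)].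
Proof. by rewrite /hdirac hdom_ofK. Qed.

Fact hrep_linear a : linear (hrep a).
Proof.
move=> c x y; rewrite -(coordK x) -(coordK y) -hdom_of_linear !hrepE.
rewrite -hdom_of_linear; congr hdom_of; apply/ffunP => s; rewrite !ffunE.
by rewrite mulrDr scalerAr.
Qed.
Fact hrepD a b x : hrep (a + b) x = hrep a x + hrep b x.
Proof.
rewrite -(coordK x) !hrepE -[hdom_of [ffun s => a * _]]scale1r.
rewrite -hdom_of_linear; congr hdom_of; apply/ffunP => s; rewrite !ffunE.
by rewrite mulrDl scale1r.
Qed.
Fact hdom_ofZ (c : R[i]) f : hdom_of (c *: f) = c *: hdom_of f.
Proof.
have z : hdom_of 0 = 0.
  by have := hdom_of_linear (-1) 0 0; rewrite scaler0 addr0 scaleN1r addNr.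
by have := hdom_of_linear c f 0; rewrite z !addr0.
Qed.
Fact hrepZ (c : R[i]) a x : hrep (c *: a) x = c *: hrep a x.
Proof.
rewrite -(coordK x) !hrepE -hdom_ofZ; congr hdom_of; apply/ffunP => s.
by rewrite !ffunE scalerAl.
Qed.
Fact hrepM a b x : hrep (a * b) x = hrep a (hrep b x).
Proof.
rewrite -(coordK x) !hrepE; congr hdom_of; apply/ffunP => s.
by rewrite !ffunE mulrA.
Qed.
Fact hrep1 x : hrep 1 x = x.
Proof.
rewrite -{2}(coordK x) -(coordK x) hrepE hdom_ofK; congr hdom_of.
by apply/ffunP => s; rewrite !ffunE mul1r.
Qed.
Fact hrep_inj a : (forall x, hrep a x = 0) -> a = 0.
Proof.
have z : hdom_of 0 = 0.
  by rewrite -[in LHS](scale0r (0 : {ffun 'I_N -> P})) hdom_ofZ scale0r.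
have N0 : (0 < N)%N by rewrite expn_gt0.
move=> h; have := h (hdom_of [ffun=> 1]); rewrite hrepE -z.
move=> /hdom_of_inj /ffunP /(_ (Ordinal N0)).
by rewrite !ffunE mulr1.
Qed.
Fact hdirac_linear : linear hdirac.
Proof.
move=> c x y; rewrite -(coordK x) -(coordK y) -hdom_of_linear !hdiracE.
rewrite -hdom_of_linear; congr hdom_of; apply/ffunP => s; rewrite !ffunE.
rewrite scaler_sumr -big_split; apply: eq_bigr => i _ /=.
rewrite scaler_sumr -big_split; apply: eq_bigr => t _ /=.
by rewrite !ffunE del_linear scalerDr !scalerA mulrC.
Qed.

Definition canonical_triple : diracTriple P :=
  @DiracTriple R[i] P hdom hrep hdirac
    hrep_linear hrepD hrepZ hrepM hrep1 hrep_inj hdirac_linear.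

Definition canonical_calculus : diffCalculus P := connes_calculus canonical_triple.

Lemma gen_unit i : gen_star A i * gen A i = 1.
Proof. by apply: val_inj; rewrite rmorphM rmorph1 /= ia_isometry. Qed.

(* 1 (x) gamma_i = S_i^* [D, S_i] *)
Lemma hgamma_opforms i : opforms canonical_triple 1 (hgamma i).
Proof.
apply/asboolP; exists (uin (gen_star A i) * ud (gen A i)).
  exact/udeg_linl/udeg_d.
rewrite PiUM PiU_in PiU_d; apply/funext => x /=.
rewrite /op_comm /op_rep /= -(coordK x); set f := coord x.
rewrite hrepE !hdiracE hgammaE hrepE -scaleN1r addrC -hdom_of_linear hrepE.
congr hdom_of; apply/ffunP => s; rewrite !ffunE scaleN1r.
rewrite mulr_sumr -sumrN -big_split (bigD1 i) //= [X in _ + X]big1 ?addr0.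
  rewrite mulr_sumr -sumrN -big_split mulr_sumr; apply: eq_bigr => t _ /=.
  rewrite ffunE delM del_gen eqxx scale1r scalerDr -scalerAr addrCA addNr addr0.
  by rewrite -scalerAr mulrA gen_unit mul1r.
move=> k ki; rewrite mulr_sumr -sumrN -big_split big1 // => t _ /=.
rewrite ffunE delM del_gen (negPf ki) scale0r mul0r add0r -scalerAr.
by rewrite addNr.
Qed.

Definition basis_form (i : 'I_n) : forms canonical_calculus 1 :=
  opcls canonical_triple 1 (hgamma i).

Section Forms.
(* Gam i j k is Gamma^i_{jk} *)
Variable (Gam : 'I_n -> 'I_n -> 'I_n -> P).
Local Notation W := canonical_calculus.
Local Notation e := basis_form.

Definition christoffel (nabla : connection W) :=
  forall i, nabla (e i) = \sum_j \sum_k ract (btens (e j) (e k)) (Gam i j k).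

Definition conn_form (i j : 'I_n) : forms W 1 :=
  \sum_k ract (e k) (Gam i j k).

Definition curv_form (i j : 'I_n) : forms W 2 :=
  \sum_(k < n) \sum_(l < n | (k < l)%N)
    ract (fwedge W (e k) (e l))
      (\sum_p (Gam p j k * Gam i p l - Gam p j l * Gam i p k)
       - partial l (Gam i j k) + partial k (Gam i j l)).
End Forms.

End Canonical.

(* Main.v *)
(* The forms [e_i] are central, closed and anticommuting, and [da] is the sum of
   the [e_i del_i(a)]. Expanding the two sides in the [e_k ^ e_l] therefore gives
   Cartan's second structure equation
     [Omega_ij = d omega_ij + \sum_p omega_pj ^ omega_ip],
   for arbitrary coefficients [Gamma^i_jk]. Applying [d], and substituting the
   structure equation for the [d omega] that appear, the terms cubic in [omega]
   cancel by associativity. *)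

Require Import Defs.
From HB Require Import structures.
From mathcomp Require Import all_boot all_order all_algebra.
From mathcomp Require Import complex.
From mathcomp Require Import boolp classical_sets functions reals topology normedtype.
Set Implicit Arguments.
Unset Strict Implicit.
Unset Printing Implicit Defensive.
Import Order.TTheory GRing.Theory Num.Theory.
Local Open Scope ring_scope.

(** * Elementary rules for the two actions on a bimodule *)

Section BimoduleTheory.
Variables (A : pzRingType) (M : bimodType A).

Lemma ract0 (a : A) : ract (0 : M) a = 0.
Proof. by apply: (@addrI _ (ract 0 a)); rewrite -ractDl !addr0. Qed.

Lemma ractr0 (x : M) : ract x 0 = 0.
Proof. by apply: (@addrI _ (ract x 0)); rewrite -ractDr !addr0. Qed.

Lemma ractN (x : M) (a : A) : ract (- x) a = - ract x a.
Proof. by apply/eqP; rewrite -addr_eq0 -ractDl addNr ract0. Qed.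

Lemma ractrN (x : M) (a : A) : ract x (- a) = - ract x a.
Proof. by apply/eqP; rewrite -addr_eq0 -ractDr addNr ractr0. Qed.

Lemma lact0l (x : M) : lact (0 : A) x = 0.
Proof. by apply: (@addrI _ (lact 0 x)); rewrite -lactDl !addr0. Qed.

Lemma lactN1 (x : M) : lact (-1 : A) x = - x.
Proof. by apply/eqP; rewrite -addr_eq0 -{2}[x]lact1 -lactDl addNr lact0l. Qed.

Lemma ract_sumr (I : Type) (r : seq I) (P : pred I) (x : M) (F : I -> A) :
  ract x (\sum_(i <- r | P i) F i) = \sum_(i <- r | P i) ract x (F i).
Proof. by apply: (big_morph (ract x)); [exact: ractDr | exact: ractr0]. Qed.

End BimoduleTheory.

(** * Products and differentials in degrees one to three *)

Section Calculus.
Variables (C : fieldType) (A : algType C) (W : diffCalculus A).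
Local Notation d := (fdiff W).

(** Equality proofs between natural numbers are unique, so [eq_k] may be taken to be reflexivity. *)
Lemma cast_deg_id k (eq_k : k = k) (x : forms W k) : cast_deg eq_k x = x.
Proof. by rewrite (eq_irrelevance eq_k erefl). Qed.

Lemma wedge_0l k l (y : forms W l) : fwedge W (0 : forms W k) y = 0.
Proof.
apply: (@addrI _ (fwedge W (0 : forms W k) y)).
by rewrite -(wedgeDl (precalcP W)) !addr0.
Qed.

Lemma wedge_0r k l (x : forms W k) : fwedge W x (0 : forms W l) = 0.
Proof.
apply: (@addrI _ (fwedge W x (0 : forms W l))).
by rewrite -(wedgeDr (precalcP W)) !addr0.
Qed.

Lemma wedge_suml k l (I : Type) (r : seq I) (P : pred I)
    (F : I -> forms W k) (y : forms W l) :
  fwedge W (\sum_(i <- r | P i) F i) y = \sum_(i <- r | P i) fwedge W (F i) y.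
Proof.
apply: (big_morph (fun x => fwedge W x y)); last exact: wedge_0l.
by move=> x x'; apply: (wedgeDl (precalcP W)).
Qed.

Lemma wedge_sumr k l (I : Type) (r : seq I) (P : pred I)
    (x : forms W k) (F : I -> forms W l) :
  fwedge W x (\sum_(i <- r | P i) F i) = \sum_(i <- r | P i) fwedge W x (F i).
Proof.
apply: (big_morph (fun y => fwedge W x y)); last exact: wedge_0r.
by move=> y y'; apply: (wedgeDr (precalcP W)).
Qed.

Lemma diff0 k : d (0 : forms W k) = 0.
Proof. by apply: (@addrI _ (d 0)); rewrite -(diffD (precalcP W)) !addr0. Qed.

Lemma diff_sum k (I : Type) (r : seq I) (P : pred I) (F : I -> forms W k) :
  d (\sum_(i <- r | P i) F i) = \sum_(i <- r | P i) d (F i).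
Proof.
by apply: (big_morph d); [exact: (diffD (precalcP W)) | exact: diff0].
Qed.

(* Fixing the degrees of a product makes its type [forms W 2] on the nose, rather
   than the merely convertible [forms W (1 + 1)]; the transports along equalities
   of degrees then disappear. *)
Definition wedge11 (x y : forms W 1) : forms W 2 := fwedge W x y.
Definition wedge12 (x : forms W 1) (y : forms W 2) : forms W 3 := fwedge W x y.
Definition wedge21 (x : forms W 2) (y : forms W 1) : forms W 3 := fwedge W x y.

Lemma wedge11A (x y z : forms W 1) :
  wedge21 (wedge11 x y) z = wedge12 x (wedge11 y z).
Proof. by rewrite -[RHS](wedgeA (precalcP W) x y z) (cast_deg_id (k := 3)). Qed.

Lemma diff_wedge11 (x y : forms W 1) :
  d (wedge11 x y) = wedge21 (d x) y - wedge12 x (d y).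
Proof.
rewrite [LHS](diffM (precalcP W) x y) (cast_deg_id (k := 3)) expr1.
by rewrite lactN1.
Qed.

(** Reading the right action as a product with a form of degree zero lets [wedgeA] and [diffM] yield
    its compatibility with products and with [d]. *)
Lemma wedge1_deg0 (x : forms W 1) (a : A) :
  (fwedge W x (deg0 W a) : forms W 1) = ract x a.
Proof. by rewrite -(wedge0r (precalcP W)) (cast_deg_id (k := 1)). Qed.

Lemma wedge2_deg0 (x : forms W 2) (a : A) :
  (fwedge W x (deg0 W a) : forms W 2) = ract x a.
Proof. by rewrite -(wedge0r (precalcP W)) (cast_deg_id (k := 2)). Qed.

Lemma wedge11_ractr (x y : forms W 1) (a : A) :
  wedge11 x (ract y a) = ract (wedge11 x y) a.
Proof.
rewrite -wedge2_deg0 -wedge1_deg0.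
by rewrite -[LHS](wedgeA (precalcP W) x y (deg0 W a)) (cast_deg_id (k := 2)).
Qed.

Lemma wedge11_ractl (x y : forms W 1) (a : A) :
  wedge11 (ract x a) y = wedge11 x (lact a y).
Proof.
rewrite -(wedge0l (precalcP W)) -wedge1_deg0.
by rewrite -[RHS](wedgeA (precalcP W) x (deg0 W a) y) (cast_deg_id (k := 2)).
Qed.

Lemma diff_ract1 (x : forms W 1) (a : A) :
  d (ract x a) = ract (d x) a - wedge11 x (d (deg0 W a)).
Proof.
rewrite -wedge2_deg0 -wedge1_deg0 [LHS](diffM (precalcP W) x (deg0 W a)).
by rewrite (cast_deg_id (k := 2)) expr1 lactN1.
Qed.

Lemma second_bianchi n (om : 'I_n -> 'I_n -> forms W 1)
    (Om : 'I_n -> 'I_n -> forms W 2) :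
    (forall i j, Om i j = d (om i j) + \sum_p wedge11 (om p j) (om i p)) ->
  forall i j, d (Om i j) =
    \sum_p (wedge21 (Om p j) (om i p) - wedge12 (om p j) (Om i p)).
Proof.
move=> Om_def i j; rewrite Om_def (diffD (precalcP W)) (diffK (precalcP W)).
rewrite add0r diff_sum; under eq_bigr do rewrite diff_wedge11.
under [RHS]eq_bigr => p _ do rewrite !Om_def {1}/wedge21 {1}/wedge12
  (wedgeDl (precalcP W)) (wedgeDr (precalcP W)) wedge_suml wedge_sumr opprD addrACA.
(* The summands containing some [d (om _ _)] already make up the left side; the cubic ones have to
   cancel. *)
rewrite [RHS]big_split /= -[LHS]addr0; congr (_ + _); apply/esym.
(* Exchanging the indices of one double sum pairs [(om q j ^ om p q) ^ om i p] with
   [om q j ^ (om p q ^ om i p)]. *)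
rewrite sumrB exchange_big; apply/eqP; rewrite subr_eq0; apply/eqP.
by apply: eq_bigr => q _; apply: eq_bigr => p _; apply: wedge11A.
Qed.

(** * A central, closed, anticommuting frame of one-forms *)

Section Frame.
Variables (n : nat) (partial : 'I_n -> A -> A) (e : 'I_n -> forms W 1).
Hypothesis e_central : forall i a, lact a (e i) = ract (e i) a.
Hypothesis e_closed : forall i, d (e i) = 0.
Hypothesis e_sq : forall i, wedge11 (e i) (e i) = 0.
Hypothesis e_anti : forall i j, i != j ->
  wedge11 (e i) (e j) = - wedge11 (e j) (e i).
Hypothesis diff_frame : forall a, d (deg0 W a) = \sum_i ract (e i) (partial i a).

(** Anticommutation merges the terms at [(k, l)] and [(l, k)], and the diagonal terms vanish. *)
Lemma sum_wedge_frame (F : 'I_n -> 'I_n -> A) :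
  \sum_k \sum_l ract (wedge11 (e k) (e l)) (F k l) =
  \sum_(k < n) \sum_(l < n | (k < l)%N)
    ract (wedge11 (e k) (e l)) (F k l - F l k).
Proof.
pose G k l := ract (wedge11 (e k) (e l)) (F k l).
rewrite -/(\sum_k \sum_l G k l).
have G_lt (k l : 'I_n) : (k < l)%N ->
    ract (wedge11 (e k) (e l)) (F k l - F l k) = G k l + G l k.
  move=> kl; rewrite ractDr ractrN /G [wedge11 (e l) _]e_anti ?ractN //.
  by rewrite -val_eqE gtn_eqF.
under [RHS]eq_bigr do under eq_bigr do rewrite G_lt //.
under [RHS]eq_bigr do rewrite big_split.
(* Exchanging the sums turns the terms [G l k] with [k < l] into those below the diagonal, row by
   row. *)
rewrite big_split /= [X in _ = _ + X](exchange_big_dep predT) //= -big_split /=.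
apply: eq_bigr => k _; rewrite (bigID (fun l : 'I_n => (k < l)%N)) /=; congr (_ + _).
rewrite (bigD1 k) ?ltnn //= {1}/G e_sq ract0 add0r; apply: eq_bigl => l.
by rewrite -leqNgt andbC ltn_neqAle.
Qed.

Lemma structure_equation (Gam : 'I_n -> 'I_n -> 'I_n -> A)
    (om := fun i j => \sum_k ract (e k) (Gam i j k)) i j :
  \sum_(k < n) \sum_(l < n | (k < l)%N)
    ract (wedge11 (e k) (e l))
      (\sum_p (Gam p j k * Gam i p l - Gam p j l * Gam i p k)
       - partial l (Gam i j k) + partial k (Gam i j l)) =
  d (om i j) + \sum_p wedge11 (om p j) (om i p).
Proof.
(* Chosen so that [F k l - F l k] is the curvature coefficient: the products will give [om ^ om],
   the derivatives [d om]. *)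
pose F k l := \sum_p Gam p j k * Gam i p l - partial l (Gam i j k).
transitivity (\sum_k \sum_l ract (wedge11 (e k) (e l)) (F k l)).
  rewrite sum_wedge_frame; apply: eq_bigr => k _; apply: eq_bigr => l _.
  congr (ract _ _); rewrite /F sumrB opprB addrA.
  by rewrite [X in X + _]addrAC [LHS]addrAC.
under eq_bigr do under eq_bigr do rewrite ractDr ractrN ract_sumr.
under eq_bigr do rewrite sumrB exchange_big.
rewrite sumrB exchange_big addrC; congr (_ + _).
  rewrite diff_sum -sumrN; apply: eq_bigr => k _.
  (* Since [e k] is closed, [d (e_k a) = - e_k ^ da], whence the sign of the derivative in [F]. *)
  rewrite diff_ract1 e_closed ract0 add0r diff_frame.
  rewrite [wedge11 _ (\sum_i _)]wedge_sumr.
  by congr (- _); apply: eq_bigr => l _; rewrite -wedge11_ractr.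
apply: eq_bigr => p _; rewrite [RHS]wedge_suml; apply: eq_bigr => k _.
rewrite [RHS]wedge_sumr; apply: eq_bigr => l _; rewrite -/(wedge11 _ _).
(* Centrality of [e l] carries the first coefficient past it, keeping the order of the two
   noncommuting coefficients. *)
by rewrite wedge11_ractl -lractA e_central -ractM wedge11_ractr.
Qed.

End Frame.
End Calculus.

(** * Vanishing of classes modulo junk *)

Section ConnesCalculus.
Variables (C : fieldType) (A : algType C) (X : diracTriple A).
Local Notation Pi := (@PiU C A X).

Lemma PiU_sum (I : Type) (r : seq I) (F : I -> univ A) :
  Pi (\sum_(i <- r) F i) = \sum_(i <- r) Pi (F i).
Proof. by apply: (big_morph (Pi)); [exact: PiUD | exact: PiU0]. Qed.

Lemma ucls_PiU k (w v : univ A) : Pi w = Pi v -> ucls X k w = ucls X k v.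
Proof. by rewrite /ucls => ->. Qed.

Lemma ucls_junk k (w v : univ A) : udeg k.+1 w -> udeg k v ->
  Pi v = 0 -> Pi (udelta v) = Pi w -> ucls X k.+1 w = 0.
Proof.
move=> hw hv v0 e.
have u0 : ucls X k.+1 0 = 0.
  have := uclsD X (udeg0 A k.+1) (udeg0 A k.+1).
  by rewrite addr0 -{1}[ucls X k.+1 0]addr0 => /addrI.
rewrite -u0; apply/ucls_eqP => //; first exact: udeg0.
by rewrite PiU0 subr0 -e; apply: junk_succ.
Qed.

Lemma ucls_eq0 k (w : univ A) : udeg k.+1 w -> Pi w = 0 -> ucls X k.+1 w = 0.
Proof.
move=> hw w0; apply: (ucls_junk (v := 0)) => //; first exact: udeg0.
  exact: PiU0.
by rewrite udelta0 PiU0.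
Qed.

End ConnesCalculus.

(** * The gamma-matrix frame of the canonical calculus *)

Section CanonicalCalculus.
Variables (R : realType) (n : nat) (A : isometryAlgebra R n).
Variables (partial : derivations A) (tau : faithfulState A) (L : gns tau).
Variable gam : gammaMatrices R n.
Local Notation P := (polyalg A).
Local Notation X := (canonical_triple partial L gam).
Local Notation W := (canonical_calculus partial L gam).
Local Notation Pi := (@PiU _ _ X).
Local Notation rep := (@op_rep _ _ X).
Local Notation comm := (@op_comm _ _ X).
Local Notation e := (basis_form partial L gam).
Local Notation gma := (@hgamma _ _ _ _ L gam).

Lemma hdom_ofD f h : hdom_of L (f + h) = hdom_of L f + hdom_of L h.
Proof. by have := hdom_of_linear L 1 f h; rewrite !scale1r. Qed.

Lemma hdom_of0 : hdom_of L 0 = 0.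
Proof. by apply: (@addrI _ (hdom_of L 0)); rewrite -hdom_ofD !addr0. Qed.

Lemma hdom_ofN f : hdom_of L (- f) = - hdom_of L f.
Proof. by apply/eqP; rewrite -addr_eq0 -hdom_ofD addNr hdom_of0. Qed.

Lemma hdom_of_sum (I : Type) (r : seq I) F :
  hdom_of L (\sum_(i <- r) F i) = \sum_(i <- r) hdom_of L (F i).
Proof. by apply: (big_morph (hdom_of L)); [exact: hdom_ofD | exact: hdom_of0]. Qed.

(** The two operators act on different tensor factors, and the matrix entries are scalars. *)
Lemma hgamma_hrep i a x : gma i (hrep a x) = hrep a (gma i x).
Proof.
rewrite -(coordK x) hrepE !hgammaE hrepE; congr hdom_of; apply/ffunP => s.
rewrite !ffunE mulr_sumr; apply: eq_bigr => t _.
by rewrite ffunE -scalerAr.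
Qed.

Lemma hgamma_hgamma i j f : gma i (gma j (hdom_of L f)) =
  hdom_of L [ffun s => \sum_t (gam i *m gam j) s t *: f t].
Proof.
rewrite !hgammaE; congr hdom_of; apply/ffunP => s; rewrite !ffunE.
under eq_bigr do rewrite ffunE scaler_sumr.
rewrite exchange_big; apply: eq_bigr => t _.
by rewrite mxE scaler_suml; apply: eq_bigr => u _; rewrite scalerA.
Qed.

Lemma hgamma_sq i x : gma i (gma i x) = x.
Proof.
rewrite -(coordK x) hgamma_hgamma gamma_sq; congr hdom_of; apply/ffunP => s.
rewrite ffunE (bigD1 s) //= big1 => [|t ts].
  by rewrite mxE eqxx scale1r addr0.
by rewrite mxE eq_sym (negPf ts) scale0r.
Qed.

Lemma hgamma_anti i j x : i != j -> gma i (gma j x) = - gma j (gma i x).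
Proof.
move=> ij; rewrite -(coordK x) !hgamma_hgamma (gamma_anti _ ij) -hdom_ofN.
congr hdom_of; apply/ffunP => s; rewrite !ffunE -sumrN; apply: eq_bigr => t _.
by rewrite [X in X *: _]mxE scaleNr.
Qed.

(** By the Leibniz rule, the terms that differentiate the vector cancel in the commutator. *)
Lemma op_commE a x :
  comm a x = \sum_i gma i (hrep (partial i a) x).
Proof.
have [f <-] := hdom_ofE x; rewrite /op_comm /op_rep /=.
rewrite hrepE !hdiracE hrepE -hdom_ofN -hdom_ofD.
under eq_bigr do rewrite hrepE hgammaE.
rewrite -hdom_of_sum; congr hdom_of; apply/ffunP => s.
rewrite sum_ffunE !ffunE mulr_sumr -sumrN -big_split /=; apply: eq_bigr => i _.
rewrite !ffunE mulr_sumr -sumrN -big_split /=; apply: eq_bigr => t _.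
by rewrite !ffunE delM scalerDr -scalerAr addrK.
Qed.

(** Meant for [S_i], its adjoint and their squares, which only the [i]-th derivation can fail to
    kill. *)
Lemma op_comm_single i a b :
  (forall j, partial j a = (j == i)%:R *: b) ->
  comm a = gma i \o rep b.
Proof.
move=> ab; apply/funext => x; rewrite op_commE (bigD1 i) //= big1 => [|j ji].
  by rewrite ab eqxx scale1r addr0.
by rewrite ab (negPf ji) scale0r hgamma_hrep; apply: (@op_rep0 _ _ X).
Qed.

(** As [gamma_i] squares to the identity, a product of two such commutators falls back into the
    algebra; this is the source of the junk. *)
Lemma comp_hgamma_op_rep i a b :
  (gma i \o rep a) \o (gma i \o rep b) = rep (a * b).
Proof.
apply/funext => x; rewrite /op_rep /= -hgamma_hrep hgamma_sq.
by rewrite hrepM.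
Qed.

Lemma op_comm_gen i : comm (gen A i) = gma i \o rep (gen A i).
Proof.
apply: op_comm_single => j.
by rewrite del_gen; case: eqP => [->|]; rewrite ?scale0r.
Qed.

Lemma op_comm_gen_star i : comm (gen_star A i) = gma i \o rep (- gen_star A i).
Proof. by apply: op_comm_single => j; rewrite del_gen_star scalerN. Qed.

(** A universal lift of [e_i], on which products and differentials of classes are computed. *)
Definition ubasis i : univ P := uin (gen_star A i) * ud (gen A i).

Lemma udeg_ubasis i : udeg 1 (ubasis i).
Proof. exact/udeg_linl/udeg_d. Qed.

Lemma PiU_ubasis i : Pi (ubasis i) = gma i.
Proof.
rewrite PiUM PiU_in PiU_d op_comm_gen.
apply/funext => x; rewrite /op_rep /= -hgamma_hrep.
by rewrite -hrepM gen_unit hrep1.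
Qed.

Lemma basis_form_ucls i : e i = ucls X 1 (ubasis i).
Proof. by rewrite /ucls PiU_ubasis. Qed.

Lemma basis_form_central i (a : P) : lact a (e i) = ract (e i) a.
Proof.
rewrite basis_form_ucls [LHS](lact_ucls X a (udeg_ubasis i)).
rewrite [RHS](ract_ucls X a (udeg_ubasis i)); apply: ucls_PiU.
rewrite [LHS]PiUM [RHS]PiUM PiU_in PiU_ubasis; apply/funext => x.
by rewrite /op_rep /= hgamma_hrep.
Qed.

Lemma wedge_basis_form i j :
  wedge11 (e i) (e j) = ucls X 2 (ubasis i * ubasis j).
Proof.
by rewrite !basis_form_ucls [LHS](wedge_ucls X (udeg_ubasis i) (udeg_ubasis j)).
Qed.

Lemma udeg_ubasisM i j : udeg 2 (ubasis i * ubasis j).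
Proof. exact: (udegM (udeg_ubasis i) (udeg_ubasis j)). Qed.

Lemma PiU_ubasisM i j : Pi (ubasis i * ubasis j) = gma i \o gma j.
Proof. by rewrite [LHS]PiUM !PiU_ubasis. Qed.

(** For distinct indices the relation already holds between the operators, before passing to the
    quotient. *)
Lemma basis_form_anti i j : i != j ->
  wedge11 (e i) (e j) = - wedge11 (e j) (e i).
Proof.
move=> ij; apply/eqP; rewrite -addr_eq0 !wedge_basis_form.
rewrite -[X in X == 0](uclsD X (udeg_ubasisM i j) (udeg_ubasisM j i)).
apply/eqP/ucls_eq0; first by apply: udegD; apply: udeg_ubasisM.
rewrite PiUD !PiU_ubasisM; apply/funext => x.
by rewrite addrfctE /= (hgamma_anti _ ij) addNr.
Qed.

Lemma del_genX2 i j :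
  partial j (gen A i ^+ 2) = (j == i)%:R *: (gen A i ^+ 2 *+ 2).
Proof.
rewrite expr2 delM del_gen; case: eqP => [->|_].
  by rewrite !scale1r mulr2n.
by rewrite !scale0r mul0r mulr0 addr0.
Qed.

Lemma del_gen_starX2 i j :
  partial j (2^-1 *: gen_star A i ^+ 2) = (j == i)%:R *: - (gen_star A i ^+ 2).
Proof.
have delZ c a : partial j (c *: a) = c *: partial j a.
  have del0 : partial j 0 = 0.
    by have := del_linear partial j (-1) 0 0; rewrite !scaleN1r !addNr.
  by have := del_linear partial j c a 0; rewrite del0 !addr0.
rewrite delZ expr2 delM del_gen_star; case: eqP => _.
  rewrite !scale1r mulNr mulrN -opprD -mulr2n -[_ * _ *+ 2]scaler_nat scalerN scalerA.
  by rewrite mulVf ?scale1r // pnatr_eq0.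
by rewrite !scale0r oppr0 mul0r mulr0 addr0 scaler0.
Qed.

(* [gamma_i ^ 2 = 1] is junk: with [S = S_i] and [T] its adjoint, [del_i]
   multiplies [S^2] by [2] and [T^2] by [-2], so that the universal form
   [T dS - 1/2 T^2 d(S^2)] represents [0] while its differential represents
   [-1 + 2 = 1]. *)
Lemma basis_form_sq i : wedge11 (e i) (e i) = 0.
Proof.
rewrite wedge_basis_form; set S := gen A i; set T := gen_star A i.
have TS : T * S = 1 by apply: gen_unit.
have TS2 : T ^+ 2 * S ^+ 2 = 1.
  by rewrite !expr2 mulrA -(mulrA T) TS mulr1 TS.
pose v := uin T * ud S - uin (2^-1 *: T ^+ 2) * ud (S ^+ 2).
have cS2 := op_comm_single (del_genX2 i); have cT2 := op_comm_single (del_gen_starX2 i).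
apply: (ucls_junk (v := v)); first exact: udeg_ubasisM.
- by apply: udegB; apply/udeg_linl/udeg_d.
- rewrite PiUB !PiUM !PiU_in !PiU_d op_comm_gen cS2; apply/eqP; rewrite subr_eq0; apply/eqP.
  apply/funext => x; rewrite /op_rep /= -!hgamma_hrep -!hrepM TS.
  rewrite -scalerAl mulrnAr TS2 -[(1 : P) *+ 2](scaler_nat 2 (1 : P)) scalerA.
  by rewrite mulVf ?scale1r // pnatr_eq0.
- rewrite udeltaD udeltaN !udeltaM !udelta_in !udelta_d !mulr0 !addr0.
  rewrite PiU_ubasisM PiUB !PiUM !PiU_d op_comm_gen op_comm_gen_star cS2 cT2.
  rewrite !comp_hgamma_op_rep.
  apply/funext => x; rewrite /= hgamma_sq.
  rewrite -[LHS]/(rep _ x - rep _ x) mulrnAr !mulNr TS TS2.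
  have -> : rep (-1) x = rep 1 x + rep (-1 *+ 2) x.
    by rewrite -op_repDl mulr2n addrA subrr add0r.
  by rewrite addrK op_rep1.
Qed.

(** With [S = S_i] and [T] its adjoint, the lift [dT dS] of [d e_i] represents [-TS = -1], while
    [e_i ^ e_i] is represented by [1]. Their sum is zero as an operator, and [e_i ^ e_i] is zero as
    a class. *)
Lemma basis_form_closed i : fdiff W (e i) = 0.
Proof.
rewrite -[LHS]addr0 -[X in _ + X](basis_form_sq i) wedge_basis_form basis_form_ucls.
rewrite [X in X + _](diff_ucls X (udeg_ubasis i)).
rewrite -[LHS](uclsD X (udeg_delta (udeg_ubasis i)) (udeg_ubasisM i i)).
apply: ucls_eq0; first exact: udegD (udeg_delta (udeg_ubasis i)) (udeg_ubasisM i i).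
rewrite PiUD PiUM !PiU_ubasis udeltaM udelta_in udelta_d mulr0 addr0 PiUM !PiU_d.
rewrite op_comm_gen op_comm_gen_star comp_hgamma_op_rep mulNr gen_unit.
apply/funext => x; rewrite addrfctE /= hgamma_sq -[X in _ + X](@op_rep1 _ _ X).
by apply: etrans (esym (@op_repDl _ _ X (-1) 1 x)) _; rewrite addNr op_rep0.
Qed.

(** This is [op_commE] read on classes, with [gamma_i] lifted to [ubasis i]. *)
Lemma diff_deg0_basis (a : P) :
  fdiff W (deg0 W a) = \sum_i ract (e i) (partial i a).
Proof.
rewrite [deg0 W a]deg0_ucls [LHS](diff_ucls X (udeg_in a)) udelta_in.
transitivity (ucls X 1 (\sum_i ubasis i * uin (partial i a))).
  apply: ucls_PiU; rewrite PiU_d PiU_sum; apply/funext => x.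
  rewrite op_commE fct_sumE; apply: eq_bigr => i _.
  by rewrite [X in _ = X x]PiUM PiU_ubasis PiU_in.
rewrite ucls_sum => [|i]; last exact/udeg_rin/udeg_ubasis.
apply: eq_bigr => i _; rewrite basis_form_ucls.
by rewrite [RHS](ract_ucls X _ (udeg_ubasis i)).
Qed.

End CanonicalCalculus.

Theorem corollary3p4 (R : realType) (n : nat) (A : isometryAlgebra R n)
    (partial : derivations A) (tau : faithfulState A) (L : gns tau)
    (gam : gammaMatrices R n)
    (T : tame (canonical_calculus partial L gam))
    (g : metric T)
    (nabla : connection (canonical_calculus partial L gam))
    (Gam : 'I_n -> 'I_n -> 'I_n -> polyalg A) :
  strongly_compatible g ->
  levi_civita g nabla ->
  christoffel Gam nabla ->
  let W := canonical_calculus partial L gam in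
  let omega := conn_form partial L gam Gam in
  let Omega := curv_form partial L gam Gam in
  forall i j : 'I_n,
    fdiff W (Omega i j) =
    \sum_(p < n) (fwedge W (Omega p j) (omega i p)
                  - fwedge W (omega p j) (Omega i p)) :> forms W 3.
Proof.
move=> _ _ _ W omega Omega; apply: second_bianchi => i j.
(* By unfolding, [curv_form] and [conn_form] are the expressions of the structure equation for the
   frame [basis_form]; its conditions on the frame remain. *)
apply: structure_equation.
- exact: basis_form_central.
- exact: basis_form_closed.
- exact: basis_form_sq.
- exact: basis_form_anti.
- exact: diff_deg0_basis.
Qed.
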